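(* Let $R_n^1=\lambda^*(f(n))\,\overline{T}(f(n))$ and $R_n^2=\overline{T}(f(n))$ (that is, $R_n^1=\lambda^*E(T_{M^*})$ and $R_n^2=E(T_{M^*})$ for the sub-layer problem conditioned on the first-hop gains $f(n)$). An optimal stopping rule for the main-layer problem, i.e. a stopping rule attaining $$\sup_{N}\frac{E(R_N^1)}{E(R_N^2+T_N)},$$ is of the form $$N^*=\min\left\{n\ge1: R_n^1-\gamma^*R_n^2\ge\gamma^*\tfrac T2\right\},$$ where $\gamma^*$ satisfies the equation $$E\left\{\max\left\{R_n^1-\gamma R_n^2-\gamma\tfrac T2,\,0\right\}\right\}=\frac{\gamma\tau}{2p_s}.$$
   Context: Let $K,L\ge1$ be integers, $T,\tau,P_s,P_r,\sigma_f^2,\sigma_g^2>0$ constants, $p_0,p_1\in(0,1)$, $p_s=Kp_0(1-p_0)^{K-1}$, $p_r=Lp_1(1-p_1)^{L-1}$. Sub-layer problem (for fixed $f=(f_1,\dots,f_L)\in\mathbb{C}^L$). For $m=1,2,\dots$: $s(m)$ is uniform on $\{1,\dots,L\}$; $K'_m$ is geometric with $\mathrm{Prob}(K'_m=k)=p_r(1-p_r)^{k-1}$, $k\ge1$; $g_1(m),\dots,g_L(m)$ are (circularly symmetric) complex Gaussian with mean zero and variance $\sigma_g^2$; all mutually independent. Put $$R_m^f=\log_2\left(1+\frac{P_sP_r|f_{s(m)}|^2|g_{s(m)}(m)|^2}{1+P_s|f_{s(m)}|^2+P_r|g_{s(m)}(m)|^2}\right),$$ sub-layer reward $\frac T2R^f_m$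 and sub-layer time $\frac T2+\frac\tau2\sum_{i=1}^mK'_i$. Let $\lambda^*(f)\ge 0$ be the unique solution of $E\{\max\{R^f_m-\lambda,0\}\}=\frac{\lambda\tau}{Tp_r}$, let $M^*=\min\{m\ge1:R^f_m\ge\lambda^*(f)\}$ (the rule maximizing the ratio of expected sub-layer reward to expected sub-layer time, with maximal value $\lambda^*(f)$), and let $\overline T(f)=E\left[\frac T2+\frac\tau2\sum_{i=1}^{M^*}K'_i\right]$, which is the quantity denoted $E(T_{M^*})$; the expected sub-layer reward under $M^*$ is $\lambda^*(f)\overline T(f)$. Main layer. For $n=1,2,\dots$: $s(n)$ is uniform on $\{1,\dots,K\}$; $K_n$ is geometric with $\mathrm{Prob}(K_n=k)=p_s(1-p_s)^{k-1}$, $k\ge1$; the gains $f_{ij}(n)$ ($1\le i\le K,1\le j\le L$) are (circularly symmetric) complex Gaussian with mean zero and variance $\sigma_f^2$; all mutually independent within and across observations. Write $f(n)=(f_{s(n)1}(n),\dots,f_{s(n)L}(n))$ and $T_n=\frac T2+\frac\tau2\sum_{i=1}^nK_i$. A main-layer stopping rule is a stopping time $N$ with values in $\{1,2,\dots\}$ with respect to the filtration generated by $(s(n),K_n,f(n))$, $n\ge1$, with $E(R_N^2+T_N)<\infty$; the main-layer problem is to maximize the system throughput $E(R^1_N)/E(R^2_N+T_N)$. *)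

(* Defs.v *)
(* MathComp + MathComp-Analysis; complex numbers R[i] from mathcomp-real-closed. *)
From HB Require Import structures.
From mathcomp Require Import all_boot all_order all_algebra finmap.
From mathcomp Require Import complex.
From mathcomp Require Import all_classical all_reals all_analysis.

Set Implicit Arguments.
Unset Strict Implicit.
Unset Printing Implicit Defensive.

Import Order.TTheory GRing.Theory Num.Theory.
Import numFieldNormedType.Exports.

Local Open Scope classical_set_scope.
Local Open Scope ring_scope.

(* Throughout, observations are numbered 1, 2, ... : the value at index 0 of a
   nat-indexed process plays no role. *)

Section randomness.
Context {R : realType} {d : measure_display} {Omega : measurableType d}.

Definition sigma_discrete (E : Type) (X : Omega -> E) : set_system Omega :=
  preimage_set_system setT X setT.

Definition sigma_complex (Z : Omega -> R[i]) : set_system Omega :=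
  preimage_set_system setT (fun w => (complex.Re (Z w), complex.Im (Z w)))
    measurable.

Variable P : probability Omega R.

Definition mutually_independent (I : choiceType) (G : I -> set_system Omega) :=
  forall (J : {fset I}) (A : I -> set Omega),
    (forall i, i \in J -> G i (A i)) ->
    P (\bigcap_(i in [set` J]) A i) = (\prod_(i <- J) P (A i))%E.

Definition uniform_index (n : nat) (X : Omega -> 'I_n) :=
  forall i, measurable (X @^-1` [set i]) /\ P (X @^-1` [set i]) = (n%:R^-1)%:E.

Definition geometric_count (p : R) (X : Omega -> nat) :=
  measurable_fun setT X /\
  forall k, (1 <= k)%N -> P (X @^-1` [set k]) = (p * (1 - p) ^+ k.-1)%:E.

(* Circular symmetry with mean 0 and variance v = E|Z|^2: the real and imaginary
   parts are independent centred Gaussians of variance v / 2 each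
   (the second parameter of [normal_prob] is the standard deviation). *)
Definition circular_gaussian (v : R) (Z : Omega -> R[i]) :=
  [/\ measurable_fun setT (fun w => complex.Re (Z w)),
      measurable_fun setT (fun w => complex.Im (Z w)) &
      forall A B : set R, measurable A -> measurable B ->
        P [set w | A (complex.Re (Z w)) /\ B (complex.Im (Z w))] =
        (normal_prob 0 (Num.sqrt (v / 2)) A *
         normal_prob 0 (Num.sqrt (v / 2)) B)%E].

End randomness.

Section common.
Context {R : realType}.

(* Probability that exactly one of n contenders transmits, each independently
   with probability p. *)
Definition success_prob (n : nat) (p : R) : R := n%:R * p * (1 - p) ^+ n.-1.

Definition elapsed (Omega : Type) (T tau : R) (Kn : nat -> Omega -> nat)
    (n : nat) (w : Omega) : R :=
  T / 2 + tau / 2 * \sum_(1 <= i < n.+1) (Kn i w)%:R.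

(* min {n >= 1 : A n}, with None when no such n exists. *)
Definition first_time (A : pred nat) : option nat :=
  if pselect (exists n, (1 <= n)%N && A n) is left h then Some (ex_minn h)
  else None.

(* The value at the random time N of the process Y, extended by Yoo at infinity. *)
Definition at_time (Omega : Type) (Yoo : \bar R) (Y : nat -> Omega -> \bar R)
    (N : Omega -> option nat) (w : Omega) : \bar R :=
  if N w is Some n then Y n w else Yoo.

End common.

Section sub_layer.
Context {R : realType} {d : measure_display} {Omega : measurableType d}.
Variables (Q : probability Omega R) (L : nat) (T tau Ps Pr pr sg2 : R).
Variables (s : nat -> Omega -> 'I_L) (Kn : nat -> Omega -> nat)
  (g : nat -> 'I_L -> Omega -> R[i]).

(* Index n of the independent family stands for observation n + 1. *)
Definition sub_layer_family (x : nat + nat + nat * 'I_L) : set_system Omega :=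
  match x with
  | inl (inl m) => sigma_discrete (s m.+1)
  | inl (inr m) => sigma_discrete (Kn m.+1)
  | inr (m, j) => sigma_complex (g m.+1 j)
  end.

Definition sub_layer_model :=
  [/\ forall m, (1 <= m)%N -> uniform_index Q (s m),
      forall m, (1 <= m)%N -> geometric_count Q pr (Kn m),
      forall m j, (1 <= m)%N -> circular_gaussian Q sg2 (g m j) &
      mutually_independent Q sub_layer_family].

Definition log2 (x : R) : R := ln x / ln 2.

Definition sub_rate (f : 'rV[R[i]]_L) (m : nat) (w : Omega) : R :=
  let F := Ps * Normc.normc (f ord0 (s m w)) ^+ 2 in
  let G := Pr * Normc.normc (g m (s m w) w) ^+ 2 in
  log2 (1 + F * G / (1 + F + G)).

Definition is_lambda_star (f : 'rV[R[i]]_L) (lam : R) :=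
  0 <= lam /\ forall m, (1 <= m)%N ->
    ('E_Q[fun w => (Num.max (sub_rate f m w - lam) 0)%R] =
     (lam * tau / (T * pr))%:E)%E.

(* The solution of [is_lambda_star f] is unique; 0 is only a formal default. *)
Definition lambda_star (f : 'rV[R[i]]_L) : R := xget 0 (is_lambda_star f).

Definition M_star (f : 'rV[R[i]]_L) (w : Omega) : option nat :=
  first_time (fun m => lambda_star f <= sub_rate f m w).

Definition T_bar (f : 'rV[R[i]]_L) : \bar R :=
  (\int[Q]_w at_time +oo (fun m w => (elapsed T tau Kn m w)%:E) (M_star f) w)%E.

End sub_layer.

Section main_layer.
Context {R : realType} {d : measure_display} {Omega : measurableType d}.
Variables (P : probability Omega R) (K L : nat) (T tau ps sf2 : R).
Variables (s : nat -> Omega -> 'I_K) (Kn : nat -> Omega -> nat)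
  (f : nat -> 'I_K -> 'I_L -> Omega -> R[i]).

(* Index n of the independent family stands for observation n + 1. *)
Definition main_layer_family (x : nat + nat + nat * 'I_K * 'I_L) :
    set_system Omega :=
  match x with
  | inl (inl n) => sigma_discrete (s n.+1)
  | inl (inr n) => sigma_discrete (Kn n.+1)
  | inr (n, i, j) => sigma_complex (f n.+1 i j)
  end.

Definition main_layer_model :=
  [/\ forall n, (1 <= n)%N -> uniform_index P (s n),
      forall n, (1 <= n)%N -> geometric_count P ps (Kn n),
      forall n i j, (1 <= n)%N -> circular_gaussian P sf2 (f n i j) &
      mutually_independent P main_layer_family].

Definition first_hop (n : nat) (w : Omega) : 'rV[R[i]]_L :=
  \row_j f n (s n w) j w.

Definition main_filtration (n : nat) : set_system Omega :=
  <<s \bigcup_(i in [set i | (1 <= i <= n)%N])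
        (sigma_discrete (s i) `|` sigma_discrete (Kn i) `|`
         \bigcup_(j in [set: 'I_L])
            sigma_complex (fun w => first_hop i w ord0 j)) >>.

Variables R1 R2 : nat -> Omega -> \bar R.

Definition mean_reward (N : Omega -> option nat) : \bar R :=
  (\int[P]_w at_time 0 R1 N w)%E.

Definition mean_duration (N : Omega -> option nat) : \bar R :=
  (\int[P]_w
     at_time +oo (fun n w => R2 n w + (elapsed T tau Kn n w)%:E) N w)%E.

(* A stopping time is finite almost surely, not surely; None means that the
   observation never stops. *)
Definition stopping_rule (N : Omega -> option nat) :=
  [/\ forall w, N w <> Some 0%N,
      forall n, (1 <= n)%N -> main_filtration n [set w | N w = Some n],
      P [set w | N w = None] = 0%E &
      (mean_duration N < +oo)%E].

Definition throughput (N : Omega -> option nat) : \bar R :=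
  (mean_reward N / mean_duration N)%E.

Definition is_gamma_star (gamma : R) :=
  forall n, (1 <= n)%N ->
    (\int[P]_w
       maxe (R1 n w - gamma%:E * R2 n w - (gamma * (T / 2))%:E) 0 =
     (gamma * tau / (2 * ps))%:E)%E.

Definition N_star (gamma : R) (w : Omega) : option nat :=
  first_time
    (fun n => ((gamma * (T / 2))%:E <= R1 n w - gamma%:E * R2 n w)%E).

End main_layer.

(* Main.v *)
Require Import Defs.
From HB Require Import structures.
From mathcomp Require Import all_boot all_order all_algebra finmap.
From mathcomp Require Import complex.
From mathcomp Require Import all_classical all_reals all_analysis.
From mathcomp Require Import measurable_realfun ring lra.

Set Implicit Arguments.
Unset Strict Implicit.
Unset Printing Implicit Defensive.

Import Order.TTheory GRing.Theory Num.Theory.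
Import numFieldNormedType.Exports.

Local Open Scope classical_set_scope.
Local Open Scope ring_scope.

(** Suppose that gamma solves the equation and let
    Z_n = max (R1_n - gamma R2_n - gamma T/2, 0) be the excess of observation n.
    For every stopping rule N, R1_N - gamma (R2_N + T/2) <= sum_(i <= N) Z_i
    pointwise, with equality for N*, whose excesses vanish before it stops.  By
    Wald's identity the right-hand side has mean E N * gamma tau / (2 ps), which
    is also gamma times the mean contention time.  Hence
    E R1_N <= gamma E (R2_N + T_N), with equality for N*.

    All observations of a layer are packed into an i.i.d. process with values in
    the space of triples (source, number of slots, gains), so that the equation
    does not depend on n and Wald's identity applies.  In the sub-layer it gives
    Tbar(f) = T/2 + tau / (2 pr q(f)) with q(f) the probability that the rate R^f
    reaches lambda*(f).  It remains to see that Tbar(f) and lambda*(f) Tbar(f) are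
    integrable in the Gaussian f.  With S = Ps sum_j |f_j|^2 and
    c = tau / (T pr), the equation for lambda* yields
    lambda* c <= q S / ln 2 and lambda* (1 + c) >= E R^f >= const * S / (1 + S),
    so that 1 / q <= const * (1 + S). *)

(** * Measures with a density *)

(** The pathwise inequality is used in the form R1_N <= gamma (R2_N + T/2) + sum_(i <= N) Z_i. All
    terms are nonnegative, so every integral lives in [0, +oo], nothing is subtracted, and the case
    E N = +oo needs no separate treatment. Two notions of past compete. A packed observation carries
    the gains of all sources, which makes it i.i.d., whereas a main-layer rule sees only the gains
    of the selected source. The upper bound is proved for all stopping times of the larger past. In
    the other direction, N* has to be adapted to the smaller filtration, which is why lambda* and
    Tbar are shown measurable when the gains depend on a parameter in an arbitrary measurable space.
    Since lambda* is given only implicitly, its measurability comes from monotonicity: the left-hand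
    side of its equation decreases in lambda and the right-hand side increases strictly, so
    comparing both sides at a fixed y decides whether lambda* <= y. *)

Section density.
Local Open Scope ereal_scope.
Context {d} {T : measurableType d} {R : realType}.
Variables (mu nu : {measure set T -> \bar R}) (h : T -> R).
Hypotheses (mh : measurable_fun setT h) (h0 : forall x, (0 <= h x)%R).
Hypothesis nuE : forall B, measurable B -> nu B = \int[mu]_(x in B) (h x)%:E.

Import HBNNSimple.

Let integral_density_nnsfun (f : {nnsfun T >-> R}) :
  \int[nu]_x (f x)%:E = \int[mu]_x ((f x)%:E * (h x)%:E).
Proof.
under [LHS]eq_integral do rewrite fimfunE -fsumEFin//.
rewrite [LHS]ge0_integral_fsum//; last 2 first.
  - by move=> r; exact/measurable_EFinP/measurableT_comp.
  - by move=> n x _; rewrite EFinM nnfun_muleindic_ge0.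
under [RHS]eq_integral.
  move=> x _; rewrite fimfunE -fsumEFin// ge0_mule_fsuml; last first.
    by move=> r; rewrite EFinM nnfun_muleindic_ge0.
  over.
rewrite [RHS]ge0_integral_fsum//; last 2 first.
  - move=> r; apply: emeasurable_funM; last exact/measurable_EFinP.
    by apply/measurable_EFinP; do 2 apply/measurableT_comp => //.
  - by move=> r x _; rewrite mule_ge0 ?lee_fin// -lee_fin EFinM nnfun_muleindic_ge0.
apply: eq_fsbigr => r _.
have [r0|r0] := leP 0%R r; last first.
  rewrite integral0_eq; last first.
    by move=> x _; rewrite /= preimage_nnfun0// indic0 mulr0.
  rewrite integral0_eq// => x _.
  by rewrite /= preimage_nnfun0// indic0 mulr0 mul0e.
under eq_integral do rewrite EFinM.
rewrite ge0_integralZl//; last first.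
  exact/measurable_EFinP.
under [RHS]eq_integral do rewrite EFinM -muleA.
rewrite ge0_integralZl//; last 2 first.
- by apply: emeasurable_funM; exact/measurable_EFinP.
- by move=> x _; rewrite mule_ge0// lee_fin.
congr (_ * _); rewrite integral_indic// setIT nuE//.
rewrite integral_mkcond; apply: eq_integral => x _.
rewrite patchE indicE; case: ifPn => xr; last by rewrite mul0e.
by rewrite mul1e.
Qed.

(** Serves twice: with an indicator as density, for restricted measures, and with the Gaussian
    density, for second moments. *)
Lemma ge0_integral_density (f : T -> \bar R) :
  measurable_fun setT f -> (forall x, 0 <= f x) ->
  \int[nu]_x f x = \int[mu]_x (f x * (h x)%:E).
Proof.
move=> mf f0; pose f_ := nnsfun_approx measurableT mf.
transitivity (lim (\int[nu]_x (f_ n x)%:E @[n --> \oo])).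
  rewrite -monotone_convergence//=.
  - apply: eq_integral => ? /[!inE] xD; apply/esym/cvg_lim => //=.
    exact: cvg_nnsfun_approx.
  - by move=> n; exact/measurable_EFinP/measurable_funTS.
  - by move=> n ? _; rewrite lee_fin.
  - by move=> ? _ ? ? mn; rewrite lee_fin; exact/lefP/nd_nnsfun_approx.
under eq_fun do rewrite integral_density_nnsfun.
rewrite -monotone_convergence//=.
- apply: eq_integral => x _; apply/cvg_lim => //=.
  apply: cvgeMr => //.
  exact: cvg_nnsfun_approx.
- move=> n; apply: emeasurable_funM; last exact/measurable_EFinP.
  exact/measurable_EFinP.
- by move=> n x _; rewrite mule_ge0// lee_fin.
- move=> x _ m n mn; rewrite lee_wpmul2r ?lee_fin//.
  exact/lefP/nd_nnsfun_approx.
Qed.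

End density.

Lemma ge0_integral_mrestr {d} {T : measurableType d} {R : realType}
    (mu : {measure set T -> \bar R}) (A : set T) (mA : measurable A)
    (f : T -> \bar R) :
  measurable_fun setT f -> (forall x, 0 <= f x)%E ->
  (\int[mrestr mu mA]_x f x = \int[mu]_(x in A) f x)%E.
Proof.
move=> mf f0.
rewrite (@ge0_integral_density _ _ _ mu _ (\1_A))//; last first.
  move=> B mB; rewrite /= integral_indic// setIC//.
rewrite [RHS]integral_mkcond; apply: eq_integral => x _.
by rewrite patchE indicE; case: ifP => _; rewrite ?mule1// mule0.
Qed.

(** * Independent observations and Wald's identity *)

Section stopping_times.
Context {R : realType} {d dV} {Omega : measurableType d} {V : measurableType dV}.
Variables (P : probability Omega R) (X : nat -> Omega -> V).

Definition past_events (n : nat) : set_system Omega :=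
  \bigcup_(i in [set i | (1 <= i <= n)%N])
    preimage_set_system setT (X i) measurable.

Definition past (n : nat) : set_system Omega := <<s past_events n >>.

(** One product formula encodes both properties: [A = setT] gives identical distribution, and
    independence of the next observation from the past is the form in which Wald's identity uses
    independence. *)
Definition iid_process :=
  (forall n, (1 <= n)%N -> measurable_fun setT (X n)) /\
  forall n A B, past n A -> measurable B ->
    P (A `&` X n.+1 @^-1` B) = (P A * P (X 1%N @^-1` B))%E.

Definition stopping (N : Omega -> option nat) :=
  (forall w, N w <> Some 0%N) /\
  forall n, (1 <= n)%N -> past n [set w | N w = Some n].

(* The event {N > n}; N = None counts as infinity. *)
Definition alive (N : Omega -> option nat) (n : nat) : set Omega :=
  [set w | forall i, (i <= n)%N -> N w <> Some i].

(** E N as the sum of the tail probabilities P(N > n). *)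
Definition mean_time (N : Omega -> option nat) : \bar R :=
  (\sum_(0 <= n <oo) P (alive N n))%E.

Lemma past_obs n i B : (1 <= i <= n)%N -> measurable B -> past n (X i @^-1` B).
Proof.
move=> ni mB; apply: sub_sigma_algebra; exists i => //; exists B => //.
by rewrite setTI.
Qed.

Lemma past_subset m n : (m <= n)%N -> past m `<=` past n.
Proof.
move=> mn; apply: sub_sigma_algebra2 => A [i /= /andP[i1 im] XA]; exists i => //=.
by rewrite i1 (leq_trans im).
Qed.

Lemma pastC n A : past n A -> past n (~` A).
Proof. exact: (@measurableC _ (g_sigma_algebraType (past_events n))). Qed.

Lemma pastI n A B : past n A -> past n B -> past n (A `&` B).
Proof. exact: (@measurableI _ (g_sigma_algebraType (past_events n))). Qed.

Lemma pastT n : past n setT.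
Proof. exact: (@measurableT _ (g_sigma_algebraType (past_events n))). Qed.

Lemma alive0 N : stopping N -> alive N 0 = setT.
Proof.
by case=> N0 _; apply/seteqP; split=> // w _ i; rewrite leqn0 => /eqP ->.
Qed.

Lemma aliveS N n : alive N n.+1 = alive N n `&` ~` [set w | N w = Some n.+1].
Proof.
apply/seteqP; split=> [w Nw|w [Nw Nn] i].
  by split=> [i /leqW|]; [exact: Nw|exact: (Nw n.+1)].
by rewrite leq_eqVlt => /predU1P[->//|]; exact: Nw.
Qed.

Lemma past_alive N n : stopping N -> past n (alive N n).
Proof.
move=> sN; elim: n => [|n IH]; first by rewrite alive0//; exact: pastT.
rewrite aliveS; apply: pastI; first exact: past_subset IH.
by apply: pastC; exact: sN.2.
Qed.

Hypothesis iidX : iid_process.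

Lemma past_measurable n A : past n A -> measurable A.
Proof.
apply: smallest_sub; first exact: sigma_algebra_measurable.
by move=> _ [i /= /andP[i1 _]] [B mB <-]; exact: iidX.1.
Qed.

Lemma obs_measurable n B : (1 <= n)%N -> measurable B ->
  measurable (X n @^-1` B).
Proof. by move=> n1 mB; rewrite -[X in measurable X]setTI; exact: iidX.1. Qed.

(** Both sides integrate [phi] over [V]: against the image under [X n.+1] of [P] restricted to [A],
    and against [P A] times the law of [X 1]. The product formula of [iid_process] says that these
    two measures coincide. *)
Lemma integral_past_obs n A (phi : V -> \bar R) : past n A ->
  measurable_fun setT phi -> (forall v, 0 <= phi v)%E ->
  (\int[P]_(w in A) phi (X n.+1 w) = P A * \int[P]_w phi (X 1%N w))%E.
Proof.
move=> pA mphi phi0; have mA := past_measurable pA.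
have mX : measurable_fun setT (X n.+1) by exact: iidX.1.
have mX1 : measurable_fun setT (X 1%N) by exact: iidX.1.
have mphiX : measurable_fun setT (phi \o X n.+1) by exact: measurableT_comp.
have phiX0 w : (0 <= (phi \o X n.+1) w)%E by exact: phi0.
rewrite -(ge0_integral_mrestr P mA mphiX phiX0).
have -> : (\int[mrestr P mA]_x (phi \o X n.+1) x =
   \int[pushforward (mrestr P mA) (X n.+1)]_v phi v)%E.
  by rewrite ge0_integral_pushforward//= preimage_setT.
have -> : (\int[P]_w phi (X 1%N w) =
   \int[pushforward P (X 1%N)]_v phi v)%E.
  by rewrite ge0_integral_pushforward//= preimage_setT.
have PA0 : 0 <= fine (P A) by exact: fine_ge0.
have PAE : P A = (NngNum PA0)%:num%:E by rewrite /= fineK// fin_num_measure.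
rewrite PAE -ge0_integral_mscale//.
apply: eq_measure_integral => B mB _.
by rewrite /= /pushforward /mrestr /mscale/= setIC iidX.2//= fineK// fin_num_measure.
Qed.

Lemma integral_obs n (phi : V -> \bar R) : (1 <= n)%N ->
  measurable_fun setT phi -> (forall v, 0 <= phi v)%E ->
  (\int[P]_w phi (X n w) = \int[P]_w phi (X 1%N w))%E.
Proof.
case: n => // n _ mphi phi0; rewrite (integral_past_obs (@pastT n))//.
by rewrite probability_setT mul1e.
Qed.

Lemma at_time_measurable N (c : \bar R) (Y : nat -> Omega -> \bar R) :
  stopping N -> (forall n, (1 <= n)%N -> measurable_fun setT (Y n)) ->
  measurable_fun setT (at_time c Y N).
Proof.
move=> sN mY _ B mB; rewrite setTI.
have mN n : measurable [set w | N w = Some n].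
  case: n => [|n]; last exact: past_measurable (sN.2 n.+1 isT).
  suff -> : [set w | N w = Some 0%N] = set0 by [].
  by apply/seteqP; split=> // w /= /sN.1.
have -> : at_time c Y N @^-1` B =
   (\bigcup_(n in [set n | (1 <= n)%N]) ([set w | N w = Some n] `&` Y n @^-1` B)) `|`
   ((~` \bigcup_n [set w | N w = Some n]) `&` [set w | B c]).
  apply/seteqP; split=> [w|w].
    rewrite /at_time /=; case Nw: (N w) => [n|] Bw.
      left; exists n => //=; case: n Nw {Bw} => // /sN.1//.
    by right; split=> // -[n _]; rewrite /= Nw.
  rewrite /at_time /= => -[[n n1 [/= -> //]]|[]].
  by case E: (N w) => [n|//] nb _; exfalso; apply: nb; exists n.
apply: measurableU.
  apply: bigcup_measurable => n n1; apply: measurableI => //.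
  by rewrite -[X in measurable X]setTI; exact: mY.
apply: measurableI; first by apply: measurableC; exact: bigcupT_measurable.
have [Bc|Bc] := pselect (B c).
  by rewrite (_ : [set _ | B c] = setT)//; apply/seteqP; split.
by rewrite (_ : [set _ | B c] = set0)//; apply/seteqP; split.
Qed.

Lemma partial_sum_measurable n (phi : V -> \bar R) : measurable_fun setT phi ->
  measurable_fun setT (fun w => \sum_(1 <= i < n.+1) phi (X i w))%E.
Proof.
move=> mphi; rewrite (_ : (fun w => _) =
    (fun w => \sum_(i < n) phi (X i.+1 w))%E).
  apply: emeasurable_sum => i; apply: measurableT_comp => //; exact: iidX.1.
by apply/funext => w; rewrite big_add1/= big_mkord.
Qed.

Lemma never_measurable N : stopping N -> measurable [set w | N w = None].
Proof.
move=> sN; rewrite (_ : [set w | N w = None] = \bigcap_n alive N n).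
  by apply: bigcapT_measurable => n; apply: (@past_measurable n); exact: past_alive.
apply/seteqP; split=> [w /= Nw n _ i _|w Nw /=]; first by rewrite Nw.
by case E: (N w) => [n|//]; have := Nw n I n (leqnn n); rewrite E.
Qed.

Lemma ge0_integral_at_time_eq N (c : \bar R) (Y : nat -> Omega -> \bar R)
    (g : Omega -> \bar R) :
  stopping N -> P [set w | N w = None] = 0%E -> (0 <= c)%E ->
  (forall n w, (1 <= n)%N -> 0 <= Y n w)%E ->
  (forall n, (1 <= n)%N -> measurable_fun setT (Y n)) ->
  measurable_fun setT g -> (forall w, 0 <= g w)%E ->
  (forall n w, N w = Some n -> g w = Y n w) ->
  (\int[P]_w at_time c Y N w = \int[P]_w g w)%E.
Proof.
move=> sN N0 c0 Y0 mY mg g0 gE; apply: ge0_ae_eq_integral => //.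
- exact: at_time_measurable.
- move=> w _; rewrite /at_time; case E: (N w) => [n|//]; apply: Y0.
  by case: n E => // /sN.1.
- exists [set w | N w = None]; split=> //; first exact: never_measurable.
  move=> w /=; apply: contra_notP; rewrite /at_time; case E: (N w) => [n|//] _ _.
  by rewrite (gE n w).
Qed.

(** The sum up to N is the series of the phi(X_(i+1)) 1_(N > i). The event N > i belongs to the past
    of i, hence is independent of X_(i+1), and nonnegative terms may be integrated one by one. *)
Lemma wald N (c : \bar R) (phi : V -> \bar R) :
  (\int[P]_w phi (X 1%N w))%E \is a fin_num ->
  stopping N -> P [set w | N w = None] = 0%E -> (0 <= c)%E ->
  measurable_fun setT phi -> (forall v, 0 <= phi v)%E ->
  (\int[P]_w at_time c (fun n w => \sum_(1 <= i < n.+1) phi (X i w)) N w =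
   mean_time N * \int[P]_w phi (X 1%N w))%E.
Proof.
move=> fphi sN N0 c0 mphi phi0.
have mX n : measurable_fun setT (fun w => phi (X n.+1 w)).
  by apply: measurableT_comp => //; exact: iidX.1.
have mal n : measurable (alive N n) by apply: (@past_measurable n); exact: past_alive.
pose g w := (\sum_(0 <= i <oo) ((fun w => phi (X i.+1 w)) \_ (alive N i)) w)%E.
have mgi i : measurable_fun setT ((fun w => phi (X i.+1 w)) \_ (alive N i)).
  by apply/(measurable_restrictT _ (mal i)); exact: measurable_funTS.
have gi0 i w : (0 <= ((fun w => phi (X i.+1 w)) \_ (alive N i)) w)%E.
  by rewrite patchE; case: ifP.
rewrite (@ge0_integral_at_time_eq N c _ g)//; last 5 first.
- by move=> n w _; apply: sume_ge0.
- by move=> n _; exact: partial_sum_measurable.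
- exact: ge0_emeasurable_sum.
- by move=> w; apply: nneseries_ge0.
- move=> n w Nw; rewrite /g.
  (* On N = n the terms of index i >= n vanish; those of index i < n are the observations 1, ...,
     n. *)
  rewrite (nneseries_split 0 n)//= add0n [X in (_ + X)%E]eseries0; last first.
    move=> i ni _; rewrite patchE memNset// => /(_ n ni); exact.
  rewrite adde0 big_add1/=; apply: eq_big_nat => i /andP[_ ni].
  rewrite patchE mem_set// => j ji; rewrite Nw => -[nj].
  by move: ni; rewrite nj ltnNge ji.
rewrite integral_nneseries//.
rewrite /mean_time muleC -(fineK fphi) -nneseriesZl//.
apply: eq_eseriesr => n _.
have pal : past n (alive N n) by exact: past_alive.
by rewrite -integral_mkcond (integral_past_obs pal)// fineK// muleC.
Qed.

End stopping_times.

(** * Waiting time until the first acceptable observation *)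

Lemma first_timeP (A : pred nat) :
  match first_time A with
  | Some n => [/\ (1 <= n)%N, A n & forall i, (1 <= i < n)%N -> ~~ A i]
  | None => forall i, (1 <= i)%N -> ~~ A i
  end.
Proof.
rewrite /first_time; case: pselect => [h|nh]; last first.
  by move=> i i1; apply/negP => Ai; apply: nh; exists i; rewrite i1.
case: ex_minnP => n /andP[n1 An] nmin; split=> // i /andP[i1 ilt].
by apply/negP => Ai; have := nmin i; rewrite i1 Ai leqNgt ilt => /(_ isT).
Qed.

Lemma geometric_eseries {R : realType} (z : R) : 0 <= z < 1 ->
  (\sum_(0 <= n <oo) (z ^+ n)%:E = ((1 - z)^-1)%:E)%E.
Proof.
move=> /andP[z0 z1]; apply/cvg_lim => //; apply: cvg_EFin.
  by apply: nearW => n; rewrite sumEFin.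
rewrite (_ : fine \o _ = series (geometric 1 z)); last first.
  apply/funext => n; rewrite /= sumEFin/= /series/=.
  by apply: eq_bigr => i _; rewrite mul1r.
by rewrite -[X in _ --> X]mul1r; apply: cvg_geometric_series; rewrite ger0_norm.
Qed.

Section first_success.
Context {R : realType} {d dV} {Omega : measurableType d} {V : measurableType dV}.
Variables (P : probability Omega R) (X : nat -> Omega -> V).
Hypothesis iidX : iid_process P X.
Variable A : V -> bool.
Hypothesis mA : measurable [set v | A v].

Let N w := first_time (fun n => A (X n w)).
Let q := fine (P (X 1%N @^-1` [set v | A v])).

Lemma alive_first_time n :
  alive N n = [set w | forall i, (1 <= i <= n)%N -> ~~ A (X i w)].
Proof.
apply/seteqP; split=> [w Nw i /andP[i1 ni]|w Aw i ni Nw].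
  have := first_timeP (fun n => A (X n w)); rewrite -/(N w).
  case E: (N w) => [k|]; last exact.
  case=> _ _; apply; rewrite i1/= ltnNge; apply/negP => ki.
  by apply: (Nw k) => //; exact: leq_trans ki ni.
have := first_timeP (fun n => A (X n w)); rewrite -/(N w) Nw => -[i1 Ai _].
by have := Aw i; rewrite i1 ni Ai => /(_ isT).
Qed.

Lemma alive_first_timeS n :
  alive N n.+1 = alive N n `&` X n.+1 @^-1` (~` [set v | A v]).
Proof.
rewrite !alive_first_time; apply/seteqP; split=> [w Aw|w [Aw An] i /andP[i1]].
  split=> [i /andP[i1 ni]|]; first by apply: Aw; rewrite i1 leqW.
  by apply/negP; apply: Aw; rewrite leqnn.
rewrite leq_eqVlt => /predU1P[->|ni]; first exact/negP.
by apply: Aw; rewrite i1.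
Qed.

(** By induction on [n], because [past_alive] presupposes [stopping X N], which is deduced from this
    fact. *)
Let past_alive_first_time n : past X n (alive N n).
Proof.
elim: n => [|n IH].
  suff -> : alive N 0 = setT by exact: pastT.
  rewrite alive_first_time; apply/seteqP; split=> // w _ i.
  by case: i => // i /andP[].
rewrite alive_first_timeS; apply: pastI; first exact: (past_subset (leqnSn n)) IH.
by apply: past_obs; [rewrite leqnn|exact: measurableC].
Qed.

Lemma first_time_stopping : stopping X N.
Proof.
split=> [w Nw|[//|n] _].
  by have := first_timeP (fun n => A (X n w)); rewrite -/(N w) Nw; case.
have -> : [set w | N w = Some n.+1] = alive N n `&` X n.+1 @^-1` [set v | A v].
  apply/seteqP; split=> [w /= Nw|w []].
    have := first_timeP (fun n => A (X n w)); rewrite -/(N w) Nw => -[_ An Ai].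
    by split=> // i ni; rewrite Nw => -[ii]; move: ni; rewrite -ii ltnn.
  move=> Nw /= An.
  have := first_timeP (fun n => A (X n w)); rewrite -/(N w).
  case E: (N w) => [k|]; last by move=> /(_ n.+1 isT); rewrite An.
  case=> k1 _ kmin; congr Some; apply/eqP; rewrite eqn_leq; apply/andP; split.
    by rewrite leqNgt; apply/negP => nk; have := kmin n.+1; rewrite nk An => /(_ isT).
  by rewrite ltnNge; apply/negP => kn; exact: (Nw k kn).
apply: pastI; first exact: (past_subset (leqnSn n)) (@past_alive_first_time n).
by apply: past_obs => //; rewrite leqnn.
Qed.

Let q01 : 0 <= q <= 1.
Proof.
have mX : measurable (X 1%N @^-1` [set v | A v]).
  exact: (obs_measurable iidX).
by rewrite /q fine_ge0//= -lee_fin fineK ?probability_le1 ?fin_num_measure.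
Qed.

Lemma probability_alive_first_time n : P (alive N n) = ((1 - q) ^+ n)%:E.
Proof.
elim: n => [|n IH].
  by rewrite (alive0 first_time_stopping) probability_setT.
rewrite alive_first_timeS iidX.2//; last exact: measurableC.
have mX : measurable (X 1%N @^-1` [set v | A v]) by exact: (obs_measurable iidX).
rewrite preimage_setC probability_setC// IH -(fineK (fin_num_measure P _ mX)).
by rewrite -/q -EFinB -EFinM exprSr.
Qed.

Hypothesis q0 : 0 < q.

Lemma first_time_finite : P [set w | N w = None] = 0%E.
Proof.
have mNone : measurable [set w | N w = None].
  exact: (never_measurable iidX first_time_stopping).
apply/eqP; rewrite eq_le measure_ge0 andbT.
have cv : ((1 - q) ^+ n)%:E @[n --> \oo] --> (0%E : \bar R).
  apply: cvg_EFin; first exact: nearW.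
  rewrite (_ : _ \o _ = geometric 1 (1 - q)); last first.
    by apply/funext => n /=; rewrite mul1r.
  apply: cvg_geometric; rewrite ger0_norm; first by rewrite ltrBlDr ltrDl.
  by rewrite subr_ge0; case/andP: q01.
(* The event of never stopping lies in every event N > n, whose probability (1 - q)^n tends to 0. *)
rewrite -(cvg_lim _ cv)//; apply: lime_ge; first exact: cvgP cv.
apply: nearW => n; rewrite -probability_alive_first_time.
apply: le_measure; rewrite ?inE//.
  by apply: (past_measurable iidX (n := n)); exact: past_alive_first_time.
by move=> w /= Nw i _; rewrite Nw.
Qed.

Lemma mean_time_first_time : mean_time P N = (q^-1)%:E.
Proof.
rewrite /mean_time; under eq_eseriesr do rewrite probability_alive_first_time.
rewrite geometric_eseries ?subKr// subr_ge0 ltrBlDr ltrDl q0 andbT.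
by case/andP: q01.
Qed.

End first_success.

(** * Optimality of the threshold rule *)

Section optimal_stopping.
Local Open Scope ereal_scope.
Context {R : realType} {d dV} {Omega : measurableType d} {V : measurableType dV}.
Variables (P : probability Omega R) (X : nat -> Omega -> V).
Hypothesis iidX : iid_process P X.
Variables (T tau ps : R) (kappa : V -> nat) (a b : V -> R).
Hypotheses (T0 : (0 < T)%R) (tau0 : (0 < tau)%R) (ps0 : (0 < ps)%R).
Hypotheses (mkappa : measurable_fun setT kappa)
  (ma : measurable_fun setT a) (mb : measurable_fun setT b).
Hypotheses (a0 : forall v, (0 <= a v)%R) (b0 : forall v, (0 <= b v)%R).
Hypothesis mean_kappa : \int[P]_w (kappa (X 1%N w))%:R%:E = (ps^-1)%:E.
Hypothesis mean_b : \int[P]_w (b (X 1%N w))%:E < +oo.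

Let R1 n w := (a (X n w))%:E.
Let R2 n w := (b (X n w))%:E.
Let Kn n w := kappa (X n w).
Let D := mean_duration P T tau Kn R2.

Let mX n : (1 <= n)%N -> measurable_fun setT (X n).
Proof. exact: iidX.1. Qed.

Let c0 : (0 <= tau / 2)%R. Proof. by rewrite divr_ge0// ltW. Qed.
Let T20 : (0 < T / 2)%R. Proof. by rewrite divr_gt0. Qed.

Let mkappaR : measurable_fun setT (fun v => (kappa v)%:R : R).
Proof. by apply: measurableT_comp. Qed.

Lemma mean_contention_time N :
  stopping X N -> P [set w | N w = None] = 0 ->
  \int[P]_w at_time +oo (fun n w =>
    \sum_(1 <= i < n.+1) (tau / 2 * (kappa (X i w))%:R)%:E) N w =
  mean_time P N * (tau / (2 * ps))%:E.
Proof.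
move=> sN N0.
have mk : measurable_fun setT (fun v => (tau / 2 * (kappa v)%:R)%:E).
  by apply/measurable_EFinP; exact: measurable_funM.
have kE : \int[P]_w (tau / 2 * (kappa (X 1%N w))%:R)%:E = (tau / (2 * ps))%:E.
  under eq_integral do rewrite EFinM.
  rewrite ge0_integralZl//; last first.
    by apply/measurable_EFinP; apply: (measurableT_comp mkappaR); exact: mX.
  by rewrite mean_kappa -EFinM invfM mulrA.
rewrite (@wald _ _ _ _ _ P X iidX N +oo (fun v => (tau / 2 * (kappa v)%:R)%:E))//.
- by rewrite kE.
- by rewrite kE.
- by move=> v; rewrite lee_fin mulr_ge0.
Qed.

(** The contention time is the part of the duration that accumulates over observations, hence the
    part governed by Wald's identity. The sub-layer uses this too, with [b] zero and [pr] in place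
    of [ps]. *)
Lemma mean_duration_split N :
  stopping X N -> P [set w | N w = None] = 0 ->
  D N = \int[P]_w at_time +oo (fun n w => (b (X n w) + T / 2)%:E) N w +
        mean_time P N * (tau / (2 * ps))%:E.
Proof.
move=> sN N0; rewrite -mean_contention_time// -ge0_integralD//; last 4 first.
- move=> w _; rewrite /at_time; case: (N w) => // n.
  by rewrite lee_fin addr_ge0// ltW.
- apply: (at_time_measurable iidX) => // n n1; apply/measurable_EFinP.
  by apply: measurable_funD => //; apply: measurableT_comp => //; exact: mX.
- move=> w _; rewrite /at_time; case: (N w) => // n.
  by apply: sume_ge0 => i _; rewrite lee_fin mulr_ge0.
- apply: (at_time_measurable iidX) => // n n1.
  apply: (@partial_sum_measurable _ _ _ _ _ P X iidX n (fun v => (tau / 2 * (kappa v)%:R)%:E)).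
  by apply/measurable_EFinP; exact: measurable_funM.
apply: eq_integral => w _; rewrite /at_time; case: (N w) => // n.
rewrite /elapsed sumEFin -!EFinD mulr_sumr; congr _%:E.
by rewrite addrA.
Qed.

Let excess gamma v := Num.max (a v - gamma * b v - gamma * (T / 2))%R 0%R.

Let mexcess gamma : measurable_fun setT (fun v => (excess gamma v)%:E).
Proof.
apply/measurable_EFinP; apply: measurable_maxr => //.
by do 2 apply: measurable_funB => //; exact: measurable_funM.
Qed.

Let excess_ge0 gamma v : (0 <= excess gamma v)%R.
Proof. by rewrite le_max lexx orbT. Qed.

Section fixed_gamma.
Variable gamma : R.
Hypothesis gamma0 : (0 <= gamma)%R.
Hypothesis gammaE :
  \int[P]_w (excess gamma (X 1%N w))%:E = (gamma * tau / (2 * ps))%:E.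

(** The pathwise upper bound for the reward. Moving gamma (R2_N + T/2) to this side keeps both
    summands nonnegative, as gamma >= 0. *)
Let budget N w := gamma%:E * at_time +oo (fun n w => (b (X n w) + T / 2)%:E) N w
  + at_time +oo (fun n w => \sum_(1 <= i < n.+1) (excess gamma (X i w))%:E) N w.

Let at_time_b_ge0 N w :
  0 <= at_time +oo (fun n w => (b (X n w) + T / 2)%:E) N w.
Proof.
rewrite /at_time; case: (N w) => // n.
by rewrite lee_fin addr_ge0// ltW.
Qed.

Let at_time_excess_ge0 N w :
  0 <= at_time +oo (fun n w => \sum_(1 <= i < n.+1) (excess gamma (X i w))%:E) N w.
Proof.
rewrite /at_time; case: (N w) => // n.
by apply: sume_ge0 => i _; rewrite lee_fin.
Qed.

Let budget_ge0 N w : 0 <= budget N w.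
Proof. by rewrite adde_ge0// mule_ge0// lee_fin. Qed.

Let mat_time_b N : stopping X N ->
  measurable_fun setT (at_time +oo (fun n w => (b (X n w) + T / 2)%:E) N).
Proof.
move=> sN; apply: (at_time_measurable iidX) => // n n1; apply/measurable_EFinP.
by apply: measurable_funD => //; apply: measurableT_comp => //; exact: mX.
Qed.

Let mat_time_excess N : stopping X N -> measurable_fun setT
  (at_time +oo (fun n w => \sum_(1 <= i < n.+1) (excess gamma (X i w))%:E) N).
Proof.
move=> sN; apply: (at_time_measurable iidX) => // n n1.
exact: (@partial_sum_measurable _ _ _ _ _ P X iidX n (fun v => (excess gamma v)%:E)).
Qed.

Let mbudget N : stopping X N -> measurable_fun setT (budget N).
Proof.
move=> sN; apply: emeasurable_funD; last exact: mat_time_excess.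
by apply: emeasurable_funM => //; exact: mat_time_b.
Qed.

(* By Wald's identity the expected number of observations carries the weight
   gamma tau / (2 ps) both in the excess and in gamma times the contention time. *)
Let integral_budget N : stopping X N -> P [set w | N w = None] = 0 ->
  \int[P]_w budget N w = gamma%:E * D N.
Proof.
move=> sN N0; rewrite /budget ge0_integralD//; last 3 first.
- by move=> w _; rewrite mule_ge0// lee_fin.
- by apply: emeasurable_funM => //; exact: mat_time_b.
- exact: mat_time_excess.
rewrite ge0_integralZl//; last exact: mat_time_b.
rewrite (@wald _ _ _ _ _ P X iidX N +oo (fun v => (excess gamma v)%:E))//; last 2 first.
- by rewrite gammaE.
- by move=> v; rewrite lee_fin.
have b_ge0 : 0 <= \int[P]_w at_time +oo (fun n w => (b (X n w) + T / 2)%:E) N w.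
  by apply: integral_ge0 => w _; exact: at_time_b_ge0.
have slots_ge0 : 0 <= mean_time P N * (tau / (2 * ps))%:E.
  rewrite mule_ge0//; first exact: nneseries_ge0.
  by rewrite lee_fin divr_ge0 ?mulr_ge0// ltW.
rewrite gammaE mean_duration_split// (ge0_muleDr _ b_ge0 slots_ge0).
by congr (_ + _); rewrite muleCA -EFinM mulrA.
Qed.

Lemma mean_reward_le N : stopping X N -> P [set w | N w = None] = 0 ->
  mean_reward P R1 N <= gamma%:E * D N.
Proof.
move=> sN N0; rewrite -integral_budget//; apply: ge0_le_integral => //.
- by move=> w _; rewrite /at_time; case: (N w) => // n; rewrite lee_fin.
- apply: (at_time_measurable iidX) => // n n1; apply/measurable_EFinP.
  by apply: measurableT_comp => //; exact: mX.
- exact: mbudget.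
move=> w _; have := budget_ge0 N w; have := sN.1 w; rewrite /budget /at_time.
case: (N w) => [[//|n] _|//] _.
rewrite sumEFin -EFinM -EFinD lee_fin big_nat_recr//=.
have : (0 <= \sum_(1 <= i < n.+1) excess gamma (X i w))%R by exact: sumr_ge0.
have : (a (X n.+1 w) - gamma * b (X n.+1 w) - gamma * (T / 2) <=
  excess gamma (X n.+1 w))%R by rewrite le_max lexx.
lra.
Qed.

Lemma mean_reward_N_star : P [set w | N_star T R1 R2 gamma w = None] = 0 ->
  stopping X (N_star T R1 R2 gamma) ->
  mean_reward P R1 (N_star T R1 R2 gamma) = gamma%:E * D (N_star T R1 R2 gamma).
Proof.
move=> N0 sN; rewrite -integral_budget//.
apply: (ge0_integral_at_time_eq iidX) => //.
- by move=> n w _; rewrite lee_fin.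
- move=> n n1; apply/measurable_EFinP.
  by apply: measurableT_comp => //; exact: mX.
- exact: mbudget.
move=> n w Nw; rewrite /budget /at_time Nw.
have := first_timeP
  (fun n => (gamma * (T / 2))%:E <= R1 n w - gamma%:E * R2 n w).
rewrite -/(N_star T R1 R2 gamma w) Nw => -[n1 + nmin].
rewrite -EFinM -EFinB lee_fin => an.
rewrite sumEFin -EFinM -EFinD; congr _%:E.
case: n n1 nmin an {Nw} => // n _ nmin an; rewrite big_nat_recr//= big_nat big1.
  by rewrite add0r /excess max_l; lra.
move=> i ni; apply/max_idPr; have := nmin i ni.
by rewrite -EFinM -EFinB lee_fin -ltNge; lra.
Qed.

End fixed_gamma.

(** The term [b (X N) + T / 2] of the stopping index is at most the sum of these terms over all
    observations up to N, and that sum has finite mean by Wald's identity. *)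
Lemma mean_duration_lty N : stopping X N -> P [set w | N w = None] = 0 ->
  mean_time P N < +oo -> D N < +oo.
Proof.
move=> sN N0 ENoo; rewrite mean_duration_split//.
have EN0 : 0 <= mean_time P N by exact: nneseries_ge0.
have fEN : mean_time P N \is a fin_num by rewrite ge0_fin_numE.
apply: lte_add_pinfty; last by rewrite -(fineK fEN) -EFinM ltry.
have bT : \int[P]_w (b (X 1%N w) + T / 2)%:E < +oo.
  under eq_integral do rewrite EFinD.
  rewrite ge0_integralD//; last 3 first.
  - by move=> w _; rewrite lee_fin.
  - by apply/measurable_EFinP; apply: measurableT_comp => //; exact: mX.
  - by move=> w _; rewrite lee_fin ltW.
  by rewrite lte_add_pinfty// integral_cst//= probability_setT mule1 ltry.
have mbT : measurable_fun setT (fun v => (b v + T / 2)%:E).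
  by apply/measurable_EFinP; exact: measurable_funD.
have fbT : \int[P]_w (b (X 1%N w) + T / 2)%:E \is a fin_num.
  rewrite ge0_fin_numE// integral_ge0// => w _.
  by rewrite lee_fin addr_ge0// ltW.
have bT0 v : 0 <= (b v + T / 2)%:E by rewrite lee_fin addr_ge0// ltW.
have := @wald _ _ _ _ _ P X iidX N +oo (fun v => (b v + T / 2)%:E) fbT sN N0
  (leey _) mbT bT0.
rewrite -(fineK fbT) -(fineK fEN) -EFinM => waldb.
apply: (@le_lt_trans _ _
  (fine (mean_time P N) * fine (\int[P]_w (b (X 1%N w) + T / 2)%:E))%:E).
  rewrite -waldb; apply: ge0_le_integral => //.
  - by move=> w _; rewrite /at_time; case: (N w).
  - apply: (at_time_measurable iidX) => // n n1.
    by apply: (measurableT_comp mbT); exact: mX.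
  - apply: (at_time_measurable iidX) => // n n1.
    exact: (@partial_sum_measurable _ _ _ _ _ P X iidX n (fun v => (b v + T / 2)%:E)).
  - move=> w _; rewrite /at_time; have := sN.1 w; case: (N w) => [[//|n] _|//].
    by rewrite big_nat_recr//= leeDr// sume_ge0.
by rewrite ltry.
Qed.

Lemma mean_duration_gt0 N : stopping X N -> P [set w | N w = None] = 0 ->
  0 < D N.
Proof.
move=> sN N0; rewrite mean_duration_split//.
apply: (@lt_le_trans _ _ (T / 2)%:E); first by rewrite lte_fin.
rewrite -[leLHS]adde0 leeD//; last first.
  rewrite mule_ge0 ?nneseries_ge0// lee_fin divr_ge0// ?mulr_ge0// ltW//.
have <- : \int[P]_w (T / 2)%:E = (T / 2)%:E.
  by rewrite integral_cst//= probability_setT mule1.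
apply: ge0_le_integral => //.
- by move=> w _; rewrite lee_fin ltW.
- apply: (at_time_measurable iidX) => // n n1; apply/measurable_EFinP.
  by apply: measurable_funD => //; apply: measurableT_comp => //; exact: mX.
- move=> w _; rewrite /at_time/=; case: (N w) => [n|]; last exact: leey.
  by rewrite lee_fin lerDr.
Qed.

Lemma throughput_le gamma N : (0 <= gamma)%R ->
  \int[P]_w (excess gamma (X 1%N w))%:E = (gamma * tau / (2 * ps))%:E ->
  stopping X N -> P [set w | N w = None] = 0 -> D N < +oo ->
  throughput P T tau Kn R1 R2 N <= gamma%:E.
Proof.
move=> g0 gE sN N0 Doo; have := mean_reward_le g0 gE sN N0.
have := mean_duration_gt0 sN N0.
rewrite /throughput -/D; case: (D N) Doo => [r|//|//] _.
rewrite lte_fin => r0.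
by rewrite inver gt_eqF// lee_pdivrMr.
Qed.

Lemma throughput_N_star gamma : (0 <= gamma)%R ->
  \int[P]_w (excess gamma (X 1%N w))%:E = (gamma * tau / (2 * ps))%:E ->
  let N := N_star T R1 R2 gamma in
  [/\ stopping X N, P [set w | N w = None] = 0, D N < +oo &
      throughput P T tau Kn R1 R2 N = gamma%:E].
Proof.
move=> g0 gE N.
pose A v := ((gamma * (T / 2))%:E <= (a v)%:E - gamma%:E * (b v)%:E).
have mA : measurable [set v | A v].
  rewrite [X in measurable X](_ : _ =
      [set v | (gamma * (T / 2) <= a v - gamma * b v)%R]).
    rewrite -[X in measurable X]setTI; apply: measurable_fun_ler => //.
    by apply: measurable_funB => //; exact: measurable_funM.
  by apply/seteqP; split=> v; rewrite /A /= lee_fin.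
have NE w : N w = first_time (fun n => A (X n w)) by [].
(* If acceptance had probability 0, the excess would vanish almost surely and the equation would
   force gamma = 0. For gamma = 0, however, every observation is accepted because [a] is
   nonnegative. *)
have q0 : (0 < fine (P (X 1%N @^-1` [set v | A v])))%R.
  have mXA : measurable (X 1%N @^-1` [set v | A v]).
    exact: (obs_measurable iidX).
  rewrite -lte_fin fineK ?fin_num_measure// lt0e measure_ge0 andbT.
  apply/eqP => PA0; move: gE; rewrite le_eqVlt in g0.
  case/predU1P: g0 => [g0|g0]; last first.
    suff -> : \int[P]_w (excess gamma (X 1%N w))%:E = 0.
      move=> /esym/eqP; rewrite eqe !mulf_eq0 invr_eq0 mulf_eq0 !gt_eqF//.
    transitivity (\int[P]_(w in X 1%N @^-1` [set v | A v])
        (excess gamma (X 1%N w))%:E).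
      rewrite integral_mkcond [RHS]integral_mkcond; apply: eq_integral => w _.
      rewrite !patchE in_setT; case: ifPn => //; rewrite notin_setE /= /A => /negP.
      rewrite -EFinM -EFinB lee_fin -ltNge /excess => h.
      by rewrite max_r//; lra.
    apply: null_set_integral => //.
    by apply/measurable_funTS; apply: (measurableT_comp (mexcess gamma)); exact: mX.
  have : X 1%N @^-1` [set v | A v] = setT.
    apply/seteqP; split=> // w _; rewrite /= /A -g0 !mul0r mul0e sube0 lee_fin.
    exact: a0.
  by move=> XT; move: PA0; rewrite XT probability_setT => /eqP; rewrite onee_eq0.
have sN : stopping X N := first_time_stopping X mA.
have N0 : P [set w | N w = None] = 0 := first_time_finite iidX mA q0.
have Doo : D N < +oo.
  by apply: mean_duration_lty => //; rewrite (mean_time_first_time iidX mA q0) ltry.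
split=> //.
rewrite /throughput -/D (mean_reward_N_star g0 gE)//.
have := mean_duration_gt0 sN N0; case: (D N) Doo => [r|//|//] _.
rewrite lte_fin => r0.
by rewrite inver gt_eqF// -!EFinM mulfK// gt_eqF.
Qed.

End optimal_stopping.

(** * Equations between a mean excess and a linear function *)

Section excess_equation.
Context {R : realType} {d} {Omega : measurableType d}.
Variables (P : probability Omega R) (a b : Omega -> R) (c : R).
Hypotheses (ma : measurable_fun setT a) (mb : measurable_fun setT b).
Hypotheses (a0 : forall w, 0 <= a w) (b0 : forall w, 0 <= b w).
Hypotheses (aoo : (\int[P]_w (a w)%:E < +oo)%E)
  (boo : (\int[P]_w (b w)%:E < +oo)%E).
Hypothesis c0 : 0 < c.

(** Common shape of the two equations: [b] is 1 for lambda*, and the second-hop duration plus T/2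
    for gamma. *)
Definition mean_excess (x : R) : \bar R :=
  (\int[P]_w (Num.max (a w - x * b w) 0)%:E)%E.

Let mex x : measurable_fun setT (fun w => (Num.max (a w - x * b w) 0)%:E).
Proof.
apply/measurable_EFinP; apply: measurable_maxr => //.
by apply: measurable_funB => //; exact: measurable_funM.
Qed.

Let ex0 x w : (0 <= (Num.max (a w - x * b w) 0)%:E)%E.
Proof. by rewrite lee_fin le_max lexx orbT. Qed.

Lemma mean_excess_ge0 x : (0 <= mean_excess x)%E.
Proof. by apply: integral_ge0 => w _; exact: ex0. Qed.

(** Pointwise, a - x b <= a - y b + |x - y| b. Besides continuity this yields finiteness (take y =
    0) and later the lower bound on lambda* by the mean rate (take x = 0). *)
Lemma mean_excess_lip x y :
  (mean_excess x <= mean_excess y + `|x - y|%:E * \int[P]_w (b w)%:E)%E.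
Proof.
rewrite -ge0_integralZl//; last 2 first.
- exact/measurable_EFinP.
- by move=> w _; rewrite lee_fin.
rewrite /mean_excess -ge0_integralD//; last 2 first.
- by move=> w _; rewrite mule_ge0// lee_fin.
- by apply: emeasurable_funM => //; exact/measurable_EFinP.
apply: ge0_le_integral => //.
- apply: emeasurable_funD => //.
  by apply: emeasurable_funM => //; exact/measurable_EFinP.
move=> w _; rewrite -EFinM -EFinD lee_fin.
have : - (x - y) * b w <= `|x - y| * b w.
  by apply: ler_wpM2r => //; rewrite -normrN; exact: ler_norm.
have : 0 <= `|x - y| * b w by rewrite mulr_ge0.
have : a w - y * b w <= Num.max (a w - y * b w) 0 by rewrite le_max lexx.
have : 0 <= Num.max (a w - y * b w) 0 by rewrite le_max lexx orbT.
move=> h1 h2 h3 h4; rewrite ge_max; apply/andP; split; lra.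
Qed.

Lemma mean_excess_anti x y : x <= y -> (mean_excess y <= mean_excess x)%E.
Proof.
move=> xy; apply: ge0_le_integral => // w _; rewrite lee_fin.
rewrite ge_max !le_max lexx !orbT andbT; apply/orP; left.
by rewrite lerD2l lerN2 ler_wpM2r.
Qed.

Lemma mean_excess0 : mean_excess 0 = (\int[P]_w (a w)%:E)%E.
Proof.
by apply: eq_integral => w _; rewrite mul0r subr0 max_l.
Qed.

Lemma mean_excess_fin x : mean_excess x \is a fin_num.
Proof.
rewrite ge0_fin_numE; last exact: mean_excess_ge0.
apply: (le_lt_trans (mean_excess_lip x 0)); rewrite mean_excess0.
apply: lte_add_pinfty => //.
have fb : (\int[P]_w (b w)%:E)%E \is a fin_num.
  by rewrite ge0_fin_numE// integral_ge0// => w _; rewrite lee_fin.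
by rewrite -(fineK fb) -EFinM ltry.
Qed.

Lemma mean_excess_continuous : continuous (fun x => fine (mean_excess x)).
Proof.
have fb : (\int[P]_w (b w)%:E)%E \is a fin_num.
  by rewrite ge0_fin_numE// integral_ge0// => w _; rewrite lee_fin.
set B := fine (\int[P]_w (b w)%:E)%E.
have B0 : 0 <= B by rewrite fine_ge0// integral_ge0// => w _; rewrite lee_fin.
have lip x y : fine (mean_excess x) <= fine (mean_excess y) + `|x - y| * B.
  rewrite -lee_fin EFinD EFinM !fineK ?mean_excess_fin//.
  exact: mean_excess_lip.
move=> x; apply/cvgrPdist_le => e e0; near=> y.
have xy : `|x - y| * (B + 1) <= e.
  rewrite -ler_pdivlMr; last by rewrite ltr_wpDl.
  near: y; apply: (@cvgr_dist_le _ _ _ (nbhs x) _ id); first exact: cvg_id.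
  by rewrite divr_gt0// ltr_wpDl.
have xyB : `|x - y| * B <= `|x - y| * (B + 1).
  by rewrite ler_wpM2l// lerDl.
rewrite ler_norml; have := lip x y; have := lip y x; rewrite distrC.
move=> h1 h2; apply/andP; split; lra.
Unshelve. all: by end_near. Qed.

Lemma excess_equation_exists :
  exists2 x, 0 <= x & mean_excess x = (x * c)%:E.
Proof.
set A := fine (mean_excess 0).
have A0 : 0 <= A by apply: fine_ge0; exact: mean_excess_ge0.
(* At A / c the line x c has reached the height A, which the nonincreasing mean excess cannot
   exceed; the crossing lies in between. *)
have B0 : 0 <= A / c by rewrite divr_ge0// ltW.
pose f x := fine (mean_excess x) - x * c.
have cf : {within `[0, A / c], continuous f}.
  apply: continuous_subspaceT => x; apply: cvgB; first exact: mean_excess_continuous.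
  by apply: cvgM; [exact: cvg_id|exact: cvg_cst].
have f0 : 0 <= f 0 by rewrite /f mul0r subr0.
have fB : f (A / c) <= 0.
  rewrite /f divfK ?gt_eqF// subr_le0 -lee_fin !fineK ?mean_excess_fin//.
  exact: mean_excess_anti.
have [|x] := IVT B0 cf (v := 0).
  by rewrite ge_min fB orbT le_max f0.
rewrite in_itv/= => /andP[x0 _] /eqP; rewrite subr_eq0 => /eqP fx.
by exists x => //; rewrite -fx fineK ?mean_excess_fin.
Qed.

(** The mean excess is nonincreasing and y c strictly increasing. The right-hand side does not
    mention the solution [x], which turns a comparison with an implicitly defined number into one
    between explicit functions of y. *)
Lemma excess_equation_le x y : mean_excess x = (x * c)%:E ->
  (x <= y) = (mean_excess y <= (y * c)%:E)%E.
Proof.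
move=> xE; apply/idP/idP => [xy|].
  by rewrite (le_trans (mean_excess_anti xy))// xE lee_fin ler_pM2r.
apply: contraTT; rewrite -!ltNge => yx.
by rewrite (lt_le_trans _ (mean_excess_anti (ltW yx)))// xE lte_fin ltr_pM2r.
Qed.

End excess_equation.

(** * The observation process of a layer *)

Lemma eq_measure_pi_system {d} {T : measurableType d} {R : realType}
    (G : set_system T) (m1 m2 : {measure set T -> \bar R}) :
  G `<=` measurable -> setI_closed G -> G setT ->
  (forall A, G A -> m1 A = m2 A) -> (m1 setT < +oo)%E ->
  forall A, <<s G >> A -> m1 A = m2 A.
Proof.
move=> mG GI GT m12 m1oo.
apply: (g_sigma_algebra_measure_unique G mG (fun=> setT)) => //.
by apply/seteqP; split=> // x _; exists 0%N.
Qed.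

Section iid_of_pi_system.
Context {R : realType} {d} {Omega : measurableType d}.
Variables (P : probability Omega R) (V : pointedType) (G : set_system V).
Hypotheses (GI : setI_closed G) (GT : G setT).
Variable X : nat -> Omega -> V.
Hypothesis mX : forall m B, (1 <= m)%N -> G B -> measurable (X m @^-1` B).
Hypothesis lawX : forall m B, (1 <= m)%N -> G B ->
  P (X m @^-1` B) = P (X 1%N @^-1` B).
Hypothesis prodX : forall n (B : nat -> set V), (forall i, G (B i)) ->
  P (\bigcap_(i in `I_n) X i.+1 @^-1` B i) =
  (\prod_(i < n) P (X i.+1 @^-1` B i))%E.

Let VG := g_sigma_algebraType G.
Let Y : nat -> Omega -> VG := X.

(** A pi-system whose generated sigma-algebra contains the past of [n]. Side [i] constrains
    observation [i.+1], since observations are numbered from 1. *)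
Let cylinders n : set_system Omega :=
  [set S | exists2 B : nat -> set V, forall i, G (B i) &
    S = \bigcap_(i in `I_n) X i.+1 @^-1` B i].

Let cylI n : setI_closed (cylinders n).
Proof.
move=> _ _ [B GB ->] [C GC ->]; exists (fun i => B i `&` C i) => [i|].
  exact: GI.
apply/seteqP; split=> [w [wB wC] i ni|w wBC]; first by split; [exact: wB|exact: wC].
by split=> i ni; have [] := wBC i ni.
Qed.

Let cylT n : cylinders n setT.
Proof. by exists (fun=> setT) => //; apply/seteqP; split. Qed.

Let mY n : (1 <= n)%N -> measurable_fun setT (Y n).
Proof.
move=> n1; apply: (@measurability _ _ Omega VG _ _ G) => // _ [B GB <-].
by rewrite setTI; exact: mX.
Qed.

Let mcyl n : cylinders n `<=` measurable.
Proof.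
move=> _ [B GB ->]; rewrite bigcap_mkord; apply: bigsetI_measurable => i _.
exact: mX.
Qed.

Let past_cyl n : past Y n `<=` <<s cylinders n >>.
Proof.
apply: smallest_sub; first exact: smallest_sigma_algebra.
move=> _ [i /= /andP[i1 ni]] [B mB <-].
suff: @measurable_fun _ _ (g_sigma_algebraType (cylinders n)) VG setT (Y i).
  by move=> /(_ measurableT B mB).
apply: (@measurability _ _ (g_sigma_algebraType (cylinders n)) VG _ _ G) => // _ [C GC <-]; rewrite setTI.
apply: sub_sigma_algebra.
exists (fun j => if j == i.-1 then C else setT) => [j|]; first by case: ifP.
apply/seteqP; split=> [w wC j nj|w /(_ i.-1)].
  by case: eqP => // ->; rewrite prednK.
by rewrite /= eqxx prednK//; exact.
Qed.

(** First of two extensions from a pi-system: here [B] stays in [G] while [A] runs through the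
    sigma-algebra of the cylinders. In [iid_of_pi_system] the set [A] is fixed and [B] is
    extended. *)
Let indep_pi n A B : <<s cylinders n >> A -> G B ->
  P (A `&` X n.+1 @^-1` B) = (P A * P (X n.+1 @^-1` B))%E.
Proof.
move=> cA GB; have mXB : measurable (X n.+1 @^-1` B) by exact: mX.
have PB0 : 0 <= fine (P (X n.+1 @^-1` B)) by exact: fine_ge0.
have PBE : (NngNum PB0)%:num%:E = P (X n.+1 @^-1` B).
  by rewrite /= fineK// fin_num_measure.
rewrite muleC -PBE.
apply: (@eq_measure_pi_system _ _ _ _ (mrestr P mXB) (mscale (NngNum PB0) P)
  (@mcyl n) (@cylI n) (cylT n)) => //; last first.
  by rewrite /= /mrestr setTI ltey_eq fin_num_measure.
move=> _ [C GC ->]; rewrite /= /mrestr /mscale PBE muleC.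
(* Intersecting with the condition on the next observation gives a cylinder with [n.+1] sides, to
   which the product formula applies. *)
pose D i := if (i < n)%N then C i else B.
have GD i : G (D i) by rewrite /D; case: ifP.
rewrite (_ : _ `&` _ = \bigcap_(i in `I_n.+1) X i.+1 @^-1` D i); last first.
  apply/seteqP; split=> [w [wC wB] i|w wD].
    by rewrite /D /= ltnS leq_eqVlt => /predU1P[->|ni]; [rewrite ltnn|rewrite ni; exact: wC].
  split=> [i ni|]; last by have := wD n (ltnSn n); rewrite /D ltnn.
  by have := wD i (ltnW ni : (i < n.+1)%N); rewrite /D ifT.
apply: (etrans (prodX _ GD)); rewrite big_ord_recr/= /D ltnn.
congr (_ * _)%E; apply: etrans (esym (prodX _ GC)).
by apply: eq_bigr => i _; rewrite ltn_ord.
Qed.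

Let law_sigma n B : (1 <= n)%N -> measurable (B : set VG) ->
  P (X n @^-1` B) = P (X 1%N @^-1` B).
Proof.
move=> n1 mB; have mYn := mY n1; have mY1 := mY (leqnn 1).
apply: (@eq_measure_pi_system _ VG _ G (pushforward P (Y n))
  (pushforward P (Y 1%N))) => //.
- by move=> A GA; exact: sub_sigma_algebra.
- by move=> A GA; exact: lawX.
- by rewrite /= /pushforward preimage_setT probability_setT ltry.
Qed.

Lemma iid_of_pi_system : iid_process P Y.
Proof.
split=> [n n1|n A B pA mB]; first exact: mY.
have cA := past_cyl pA.
have mA : measurable A.
  by move: A cA {pA}; apply: smallest_sub => //; exact: sigma_algebra_measurable.
have PA0 : 0 <= fine (P A) by exact: fine_ge0.
have PAE : (NngNum PA0)%:num%:E = P A by rewrite /= fineK// fin_num_measure.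
have mYn : measurable_fun setT (Y n.+1) by exact: mY.
rewrite -(@law_sigma n.+1)// setIC -PAE.
apply: (@eq_measure_pi_system _ VG _ G (pushforward (mrestr P mA) (Y n.+1))
  (mscale (NngNum PA0) (pushforward P (Y n.+1)))) => //.
- by move=> C GC; exact: sub_sigma_algebra.
- move=> C GC.
  by rewrite /= /pushforward /mrestr /mscale PAE setIC indep_pi.
- by rewrite /= /pushforward /mrestr preimage_setT setTI ltey_eq fin_num_measure.
Qed.

End iid_of_pi_system.

(** Mutual independence speaks of finite subsets of the index type, while a cylinder is a grid of
    times and components; the injection [h] places the grid inside the index type. *)
Lemma mutually_independent_grid {R : realType} {d} {Omega : measurableType d}
    (P : probability Omega R) (W : finType) (I : choiceType)
    (G : I -> set_system Omega) (h : nat * W -> I) (n : nat)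
    (A : nat -> W -> set Omega) :
  injective h -> mutually_independent P G ->
  (forall i w, G (h (i, w)) (A i w)) ->
  P (\bigcap_(i in `I_n) \bigcap_(w in [set: W]) A i w) =
  (\prod_(i < n) \prod_(w : W) P (A i w))%E.
Proof.
move=> hinj indG GA.
pose h' (p : 'I_n * W) := h (val p.1, p.2).
have h'inj : injective h'.
  by move=> [i w] [j u] /hinj[/val_inj -> ->].
pose s := map h' (enum (('I_n * W)%type : finType)).
pose J : {fset I} := [fset x in s]%fset.
(* Transports [A] along [h] without an inverse: by injectivity at most one set is intersected, and
   outside the image of [h] the intersection is the whole space. *)
pose B x := \bigcap_(p in [set p | h p = x]) A p.1 p.2.
have BE i w : B (h (i, w)) = A i w.
  apply/seteqP; split=> [x Bx|x Ax [j u] /= /hinj[-> ->]//].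
  exact: (Bx (i, w)).
have memJ x : (x \in J) = (x \in s) by rewrite inE.
have pJ : perm_eq (enum_fset J) s.
  by apply: uniq_perm; rewrite ?fset_uniq// map_inj_uniq// enum_uniq.
have := indG J B; rewrite (perm_big s pJ).
rewrite big_map big_enum/= => H.
transitivity (P (\bigcap_(x in [set` J]) B x)).
  congr (P _); apply/seteqP; split=> [y Ay x|y By i /= ni w _].
    rewrite /= memJ => /mapP[[i w] _ ->]; rewrite BE.
    exact: (Ay _ (ltn_ord i) w).
  rewrite -BE; apply: By; rewrite /= memJ.
  by apply/mapP; exists (Ordinal ni, w); rewrite ?mem_enum.
rewrite H; last first.
  by move=> x; rewrite memJ => /mapP[[i w] _ ->]; rewrite BE; exact: GA.
by rewrite pair_bigA; apply: eq_bigr => -[i w] _; rewrite BE.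
Qed.

Section observation_space.
Context {R : realType}.
Variables (E : pointedType) (J : finType).

(* A complex gain is stored as the pair of its real and imaginary parts, since
   R[i] carries no measurable structure. *)
Definition box (C : set E) (D : set nat) (A B : J -> set R) :
    set (E * nat * (J -> R * R)) :=
  [set x | [/\ C x.1.1, D x.1.2 & forall j, A j (x.2 j).1 /\ B j (x.2 j).2]].

Definition boxes : set_system (E * nat * (J -> R * R)) :=
  [set S | exists C D A B, [/\ forall j, measurable (A j),
    forall j, measurable (B j) & S = box C D A B]].

Definition obs_space := g_sigma_algebraType boxes.

Lemma boxesI : setI_closed boxes.
Proof.
move=> _ _ [C [D [A [B [mA mB ->]]]]] [C' [D' [A' [B' [mA' mB' ->]]]]].
exists (C `&` C'), (D `&` D'), (fun j => A j `&` A' j), (fun j => B j `&` B' j).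
split=> [j|j|]; [exact: measurableI|exact: measurableI|].
apply/seteqP; split=> x.
  by case=> -[? ? AB] [? ? AB']; split=> // j; have [? ?] := AB j; have [? ?] := AB' j.
by case=> -[? ?] [? ?] AB; split; split=> // j; have [[? ?] [? ?]] := AB j.
Qed.

Lemma boxesT : boxes setT.
Proof.
exists setT, setT, (fun=> setT), (fun=> setT); split=> // .
by apply/seteqP; split=> // x _; split.
Qed.

Lemma measurable_box C D A B :
  (forall j, measurable (A j)) -> (forall j, measurable (B j)) ->
  measurable (box C D A B : set obs_space).
Proof.
by move=> mA mB; apply: sub_sigma_algebra; exists C, D, A, B.
Qed.

Lemma measurable_source (C : set E) : measurable [set v : obs_space | C v.1.1].
Proof.
rewrite (_ : [set v | C v.1.1] = box C setT (fun=> setT) (fun=> setT)).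
  exact: measurable_box.
by apply/seteqP; split=> [v Cv|v []].
Qed.

Lemma measurable_slots : measurable_fun setT (fun v : obs_space => v.1.2).
Proof.
move=> _ D _; rewrite setTI.
rewrite (_ : _ @^-1` D = box setT D (fun=> setT) (fun=> setT)).
  exact: measurable_box.
by apply/seteqP; split=> [v Cv|v []].
Qed.

Lemma measurable_gain_re j : measurable_fun setT (fun v : obs_space => (v.2 j).1).
Proof.
move=> _ S mS; rewrite setTI.
rewrite (_ : _ @^-1` S = box setT setT (fun i => if i == j then S else setT) (fun=> setT)).
  by apply: measurable_box => // i; case: ifP.
apply/seteqP; split=> [v Cv|v [_ _ /(_ j)]]; last by rewrite eqxx => -[].
by split=> // i; case: eqP => // ->.
Qed.

Lemma measurable_gain_im j : measurable_fun setT (fun v : obs_space => (v.2 j).2).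
Proof.
move=> _ S mS; rewrite setTI.
rewrite (_ : _ @^-1` S = box setT setT (fun=> setT) (fun i => if i == j then S else setT)).
  by apply: measurable_box => // i; case: ifP.
apply/seteqP; split=> [v Cv|v [_ _ /(_ j)]]; last by rewrite eqxx => -[].
by split=> // i; case: eqP => // ->.
Qed.

End observation_space.

Lemma eq_countable_law {R : realType} {d} {Omega : measurableType d}
    (P : probability Omega R) (E : countType) (X Y : Omega -> E) :
  (forall e, measurable (X @^-1` [set e])) ->
  (forall e, measurable (Y @^-1` [set e])) ->
  (forall e, P (X @^-1` [set e]) = P (Y @^-1` [set e])) ->
  forall C, measurable (X @^-1` C) /\ P (X @^-1` C) = P (Y @^-1` C).
Proof.
move=> mX mY XY C.
(* Decomposes the preimage of [C] into atoms indexed by codes. The test on [pickle e] makes the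
   pieces disjoint, since several codes may decode to the same element. *)
pose F (Z : Omega -> E) (n : nat) : set Omega :=
  if choice.unpickle n is Some e then
    if (choice.pickle e == n) && `[<C e>] then Z @^-1` [set e] else set0 else set0.
have FE Z : Z @^-1` C = \bigcup_n F Z n.
  apply/seteqP; split=> [w Cw|w [n _]].
    by exists (choice.pickle (Z w)) => //; rewrite /F /= choice.pickleK eqxx/= asboolT.
  rewrite /F; case: choice.unpickle => [e|//]; case: ifP => // /andP[_ /asboolP Ce].
  by move=> /= ->.
have mF Z : (forall e, measurable (Z @^-1` [set e])) -> forall n, measurable (F Z n).
  by move=> mZ n; rewrite /F; case: choice.unpickle => [e|//]; case: ifP.
have tF Z : trivIset setT (F Z).
  move=> m n _ _ [w [+ +]]; rewrite /F.
  case: choice.unpickle => [e|//]; case: ifP => // /andP[/eqP <- _] /= <-.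
  by case: choice.unpickle => [e'|//]; case: ifP => // /andP[/eqP <- _] /= <-.
split; first by rewrite FE; apply: bigcupT_measurable; exact: mF.
have PF Z : (forall e, measurable (Z @^-1` [set e])) ->
    P (\bigcup_n F Z n) = (\sum_(n <oo) P (F Z n))%E.
  move=> mZ; rewrite measure_bigcup//; last by move=> n _; exact: mF.
  by apply: eq_eseriesl => n; rewrite in_setT.
rewrite !FE (PF X mX) (PF Y mY).
by apply: eq_eseriesr => n _; rewrite /F; case: choice.unpickle => [e|//]; case: ifP.
Qed.

HB.instance Definition _ n := isPointed.Build 'I_n.+1 ord0.

Section contention_model.
Context {R : realType} {d} {Omega : measurableType d} {n : nat} {J : finType}
  {I : choiceType}.
Variables (P : probability Omega R) (p v : R).
Variables (s : nat -> Omega -> 'I_n.+1) (Kn : nat -> Omega -> nat)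
  (z : nat -> J -> Omega -> R[i]).
Variables (G : I -> set_system Omega) (h : nat * option (option J) -> I).
Hypothesis hs : forall m, (1 <= m)%N -> uniform_index P (s m).
Hypothesis hK : forall m, (1 <= m)%N -> geometric_count P p (Kn m).
Hypothesis hz : forall m j, (1 <= m)%N -> circular_gaussian P v (z m j).
Hypothesis hind : mutually_independent P G.
Hypothesis hinj : injective h.
Hypothesis hGs : forall m, G (h (m, None)) = sigma_discrete (s m.+1).
Hypothesis hGK : forall m, G (h (m, Some None)) = sigma_discrete (Kn m.+1).
Hypothesis hGz : forall m j,
  G (h (m, Some (Some j))) = sigma_complex (z m.+1 j).
Hypothesis p0 : 0 < p.

Definition observation (m : nat) (w : Omega) : @obs_space R 'I_n.+1 J :=
  (s m w, Kn m w, fun j => (complex.Re (z m j w), complex.Im (z m j w))).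

(** [u] runs over the components of one observation. The map [h] embeds pairs of a time and a
    component into the index type of the independent family, so that both layers can share this
    section. *)
Let atom m (C : set 'I_n.+1) (D : set nat) (A B : J -> set R)
    (u : option (option J)) : set Omega :=
  match u with
  | None => s m @^-1` C
  | Some None => Kn m @^-1` D
  | Some (Some j) =>
      [set w | A j (complex.Re (z m j w)) /\ B j (complex.Im (z m j w))]
  end.

Let preimage_box m C D A B :
  observation m @^-1` box C D A B = \bigcap_(u in setT) atom m C D A B u.
Proof.
apply/seteqP; split=> [w [/= ? ? ?] [[j|]|] _//|w Aw].
by split=> [|| j]; [exact: (Aw None)|exact: (Aw (Some None))|
  exact: (Aw (Some (Some j)))].
Qed.

Let G_atom m C D A B u : (forall j, measurable (A j)) ->
  (forall j, measurable (B j)) -> G (h (m, u)) (atom m.+1 C D A B u).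
Proof.
move=> mA mB; case: u => [[j|]|].
- rewrite hGz; exists (A j `*` B j); first exact: measurableX.
  by rewrite setTI; apply/seteqP; split=> w.
- by rewrite hGK; exists D => //; rewrite setTI.
- by rewrite hGs; exists C => //; rewrite setTI.
Qed.

Let law_s m C : (1 <= m)%N ->
  measurable (s m @^-1` C) /\ P (s m @^-1` C) = P (s 1%N @^-1` C).
Proof.
move=> m1; apply: eq_countable_law => e.
- exact: (hs m1 e).1.
- exact: (hs (leqnn 1) e).1.
- exact: etrans (hs m1 e).2 (esym (hs (leqnn 1) e).2).
Qed.

(** [p] is the probability of the value 1. *)
Let p1 : p <= 1.
Proof.
have [mK /(_ 1%N isT)] := hK (leqnn 1); rewrite expr0 mulr1 => PK1.
rewrite -lee_fin -PK1 probability_le1// -[X in measurable X]setTI; exact: mK.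
Qed.

(** Sums the geometric masses above [k]. For [k = 0] the total is 1, so the value 0, whose
    probability [geometric_count] does not prescribe, is null; the tails also give the mean. *)
Let geometric_tail m k : (1 <= m)%N ->
  P [set w | (k < Kn m w)%N] = ((1 - p) ^+ k)%:E.
Proof.
move=> m1; have [mK PK] := hK m1.
have mKe e : measurable (Kn m @^-1` [set e]).
  by rewrite -[X in measurable X]setTI; exact: mK.
have -> : [set w | (k < Kn m w)%N] = \bigcup_i (Kn m @^-1` [set (k + i).+1]).
  apply/seteqP; split=> [w kK|w [i _ /= ->]]; last by rewrite ltnS leq_addr.
  by exists (Kn m w - k.+1)%N => //=; rewrite -addSn subnKC.
rewrite measure_bigcup//; last first.
  by move=> i j _ _ [w [/= -> []]] /addnI.
under eq_eseriesl do rewrite in_setT.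
transitivity (\sum_(0 <= i <oo) ((p * (1 - p) ^+ k)%:E * ((1 - p) ^+ i)%:E))%E.
  apply: eq_eseriesr => i _; apply: (etrans (PK (k + i).+1 isT)).
  by rewrite /= exprD -EFinM mulrA.
rewrite nneseriesZl; last by move=> i _; rewrite lee_fin exprn_ge0// subr_ge0.
rewrite geometric_eseries ?subr_ge0 ?p1 ?ltrBlDr ?ltrDl ?p0//.
by rewrite subKr -EFinM mulrAC divff ?mul1r// gt_eqF.
Qed.

Let law_K m D : (1 <= m)%N ->
  measurable (Kn m @^-1` D) /\ P (Kn m @^-1` D) = P (Kn 1%N @^-1` D).
Proof.
move=> m1; have [mK PK] := hK m1; have [mK1 PK1] := hK (leqnn 1).
have mKe i e : (1 <= i)%N -> measurable (Kn i @^-1` [set e]).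
  by move=> i1; rewrite -[X in measurable X]setTI; exact: (hK i1).1.
apply: eq_countable_law => [e|e|[|e]]; try exact: mKe.
  have P0 i : (1 <= i)%N -> P (Kn i @^-1` [set 0%N]) = 0%E.
    move=> i1; have -> : Kn i @^-1` [set 0%N] = ~` [set w | (0 < Kn i w)%N].
      apply/seteqP; split=> w /=; first by move=> ->.
      by move/negP; rewrite -leqNgt leqn0 => /eqP.
    rewrite probability_setC ?geometric_tail// ?subee//.
    have -> : [set w | (0 < Kn i w)%N] = ~` (Kn i @^-1` [set 0%N]).
      apply/seteqP; split=> w /=; first by move=> + K0; rewrite K0.
      by move/eqP; rewrite lt0n.
    by apply: measurableC; exact: mKe.
  exact: etrans (P0 m m1) (esym (P0 1%N isT)).
exact: etrans (PK e.+1 isT) (esym (PK1 e.+1 isT)).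
Qed.

Let measurable_atom m C D A B u : (1 <= m)%N -> (forall j, measurable (A j)) ->
  (forall j, measurable (B j)) -> measurable (atom m C D A B u).
Proof.
move=> m1 mA mB; case: u => [[j|]|]; last 2 first.
- by have [] := law_K D m1.
- by have [] := law_s C m1.
have [mRe mIm _] := hz j m1; apply: measurableI.
- by rewrite -[X in measurable X]setTI; exact: mRe.
- by rewrite -[X in measurable X]setTI; exact: mIm.
Qed.

Let prob_atom m C D A B u : (1 <= m)%N -> (forall j, measurable (A j)) ->
  (forall j, measurable (B j)) ->
  P (atom m C D A B u) = P (atom 1 C D A B u).
Proof.
move=> m1 mA mB; case: u => [[j|]|]; last 2 first.
- by have [] := law_K D m1.
- by have [] := law_s C m1.
have [_ _ PAB] := hz j m1; have [_ _ PAB1] := hz j (leqnn 1).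
by rewrite /= PAB// PAB1.
Qed.

Let prob_box m C D A B : (1 <= m)%N -> (forall j, measurable (A j)) ->
  (forall j, measurable (B j)) ->
  P (observation m @^-1` box C D A B) = (\prod_u P (atom m C D A B u))%E.
Proof.
case: m => // m _ mA mB.
(* A grid with a single row: the shift makes row 0 the observation [m.+1]. *)
pose h' (x : nat * option (option J)) := h (m + x.1, x.2)%N.
have h'inj : injective h' by move=> [i u] [j w] /hinj[/addnI -> ->].
have := @mutually_independent_grid _ _ _ P _ _ G h' 1
  (fun i u => atom (m + i).+1 C D A B u) h'inj hind.
rewrite big_ord1 addn0 => <-; last by move=> i u; exact: G_atom.
rewrite preimage_box; congr (P _); apply/seteqP; split=> [w Aw [|//] _|w Aw].
  by rewrite addn0.
by have := Aw 0%N (ltn0Sn 0); rewrite addn0.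
Qed.

Lemma iid_observation : iid_process P observation.
Proof.
apply: iid_of_pi_system.
- exact: boxesI.
- exact: boxesT.
- move=> m _ m1 [C [D [A [B [mA mB ->]]]]]; rewrite preimage_box.
  rewrite -[X in measurable X](_ : \big[setI/setT]_u atom m C D A B u = _).
    by apply: bigsetI_measurable => u _; exact: measurable_atom.
  by rewrite -bigcap_seq_cond; apply/seteqP; split=> w Aw u _; apply: Aw;
    rewrite //= mem_index_enum.
- move=> m _ m1 [C [D [A [B [mA mB ->]]]]]; rewrite !prob_box//.
  by apply: eq_bigr => u _; exact: prob_atom.
- move=> k B /choice[C] /choice[D] /choice[A1] /choice[A2] H.
  have mA1 i j : measurable (A1 i j) by have [] := H i.
  have mA2 i j : measurable (A2 i j) by have [] := H i.
  have BE i : B i = box (C i) (D i) (A1 i) (A2 i) by have [] := H i.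
  have := @mutually_independent_grid _ _ _ P _ _ G h k
    (fun i u => atom i.+1 (C i) (D i) (A1 i) (A2 i) u) hinj hind.
  rewrite (_ : \bigcap_(i < k) _ =
     \bigcap_(i < k) observation i.+1 @^-1` B i); last first.
    by apply: eq_bigcapr => i _; rewrite BE preimage_box.
  move=> ->; last by move=> i u; exact: G_atom.
  apply: eq_bigr => i _; rewrite BE; apply: esym.
  exact: (@prob_box i.+1 (C i) (D i) (A1 i) (A2 i)).
Qed.

Lemma geometric_mean m : (1 <= m)%N ->
  (\int[P]_w (Kn m w)%:R%:E = (p^-1)%:E)%E.
Proof.
move=> m1; have [mK PK] := hK m1.
have mt k : measurable [set w | (k < Kn m w)%N].
  by have [] := law_K [set i | (k < i)%N] m1.
transitivity (\int[P]_w (\sum_(0 <= k <oo) (\1_[set w | (k < Kn m w)%N] w)%:E))%E.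
  apply: eq_integral => w _; rewrite (nneseries_split 0 (Kn m w)); last first.
    by move=> k _; rewrite lee_fin.
  rewrite add0n [X in (_ + X)%E]eseries0; last first.
    by move=> k nk _; rewrite indicE memNset//= ltnNge nk.
  rewrite adde0 sumEFin big_mkord (eq_bigr (fun=> 1)); last first.
    by move=> i _; rewrite indicE mem_set/=.
  by rewrite sumr_const card_ord.
rewrite integral_nneseries//; last first.
  by move=> k; apply/measurable_EFinP; exact: measurable_indic.
transitivity (\sum_(0 <= k <oo) ((1 - p) ^+ k)%:E)%E.
  apply: eq_eseriesr => k _; rewrite integral_indic// setIT.
  exact: geometric_tail.
rewrite geometric_eseries ?subKr// subr_ge0 p1/= ltrBlDr ltrDl//.
Qed.

End contention_model.

(** * Second moments and null sets of circular Gaussians *)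

Section gaussian.
Context {R : realType}.

(** x^2 times the density with deviation t is dominated by a multiple of the density with deviation
    2t. With u = x^2 / (8 t^2) the two exponentials are exp(-4u) and exp(-u), and u exp(-3u) <= 1;
    [C] collects 8 t^2 and the ratio of the peaks. *)
Lemma normal_second_moment (t : R) : t != 0 ->
  (\int[normal_prob 0 t]_x (x ^+ 2)%:E < +oo)%E.
Proof.
move=> t0; have t2 : 0 < t ^+ 2 by rewrite exprn_even_gt0.
have dt0 : 2 * t != 0 by rewrite mulf_neq0.
rewrite (@ge0_integral_density _ _ _ lebesgue_measure _ (normal_pdf 0 t))//;
  last 4 first.
- exact: measurable_normal_pdf.
- by move=> x; exact: normal_pdf_ge0.
- by apply/measurable_EFinP; exact: measurable_funX.
- by move=> x; rewrite lee_fin sqr_ge0.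
pose C := 8 * t ^+ 2 * normal_peak t / normal_peak (2 * t).
have C0 : 0 <= C.
  rewrite divr_ge0 ?normal_peak_ge0// mulr_ge0 ?normal_peak_ge0//.
  by rewrite mulr_ge0 ?sqr_ge0.
apply: (@le_lt_trans _ _
    (\int[lebesgue_measure]_x (C%:E * (normal_pdf 0 (2 * t) x)%:E))%E).
  apply: ge0_le_integral => //.
  - by move=> x _; rewrite mule_ge0// lee_fin ?sqr_ge0 ?normal_pdf_ge0.
  - apply: emeasurable_funM; apply/measurable_EFinP; last exact: measurable_normal_pdf.
    exact: measurable_funX.
  - apply: emeasurable_funM => //.
    by apply/measurable_EFinP; exact: measurable_normal_pdf.
  move=> x _; rewrite -!EFinM lee_fin !normal_pdfE// /normal_fun subr0.
  pose u := x ^+ 2 / (8 * t ^+ 2).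
  have u0 : 0 <= u by rewrite divr_ge0 ?sqr_ge0// mulr_ge0 ?sqr_ge0.
  have -> : - x ^+ 2 / (t ^+ 2 *+ 2) = - u - 3 * u by rewrite /u; field.
  have -> : - x ^+ 2 / ((2 * t) ^+ 2 *+ 2) = - u by rewrite /u; field.
  have -> : x ^+ 2 = 8 * t ^+ 2 * u by rewrite /u; field.
  rewrite expRD /C [leRHS]mulrA divfK ?gt_eqF ?normal_peak_gt0//.
  have u1 : u * expR (- (3 * u)) <= 1.
    rewrite expRN ler_pdivrMr ?expR_gt0// mul1r.
    by have := expR_ge1Dx (3 * u); lra.
  rewrite [leLHS](_ : _ = 8 * t ^+ 2 * normal_peak t * expR (- u) *
    (u * expR (- (3 * u)))); last by ring.
  rewrite ler_piMr// mulr_ge0 ?expR_ge0// mulr_ge0 ?normal_peak_ge0//.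
  by rewrite mulr_ge0 ?sqr_ge0.
rewrite ge0_integralZl//; last 2 first.
- by apply/measurable_EFinP; exact: measurable_normal_pdf.
- by move=> x _; rewrite lee_fin normal_pdf_ge0.
by rewrite integral_normal_pdf mule1 ltry.
Qed.

Lemma normal_prob_point (t : R) (x : R) : normal_prob 0 t [set x] = 0%E.
Proof.
have /null_content_dominatesP/(_ [set x] _ (lebesgue_measure_set1 x)) :=
  normal_prob_dominates 0 t.
exact.
Qed.

Context {d} {Omega : measurableType d} (P : probability Omega R).

Lemma gaussian_second_moment (Y : Omega -> R) (t : R) : t != 0 ->
  measurable_fun setT Y ->
  (forall A, measurable A -> P (Y @^-1` A) = normal_prob 0 t A) ->
  (\int[P]_w (Y w ^+ 2)%:E < +oo)%E.
Proof.
move=> t0 mY lawY.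
(* [normal_prob] is a measure on [measurableTypeR R], which has the measurable
   sets of R but another display. *)
pose Y' : Omega -> measurableTypeR R := Y.
have mY' : measurable_fun setT Y' by exact: mY.
have msqr : measurable_fun setT (fun x : measurableTypeR R => (x ^+ 2)%:E).
  by apply/measurable_EFinP; exact: measurable_funX.
have -> : (\int[P]_w (Y w ^+ 2)%:E = \int[pushforward P Y']_x (x ^+ 2)%:E)%E.
  rewrite ge0_integral_pushforward//= ?preimage_setT// => x _.
  by rewrite lee_fin sqr_ge0.
have -> : (\int[pushforward P Y']_x (x ^+ 2)%:E =
    \int[normal_prob 0 t]_x (x ^+ 2)%:E)%E.
  by apply: eq_measure_integral => A mA _; exact: lawY.
exact: normal_second_moment.
Qed.

Variables (v : R) (Z : Omega -> R[i]).
Hypotheses (v0 : 0 < v) (hZ : circular_gaussian P v Z).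

Let t0 : Num.sqrt (v / 2) != 0.
Proof. by rewrite gt_eqF// sqrtr_gt0 divr_gt0. Qed.

Let law_re A : measurable A ->
  P ((fun w => complex.Re (Z w)) @^-1` A) = normal_prob 0 (Num.sqrt (v / 2)) A.
Proof.
move=> mA; have [_ _ /(_ A setT mA measurableT)] := hZ.
rewrite probability_setT mule1 => <-; congr (P _).
by apply/seteqP; split=> [w ?|w []].
Qed.

Let law_im A : measurable A ->
  P ((fun w => complex.Im (Z w)) @^-1` A) = normal_prob 0 (Num.sqrt (v / 2)) A.
Proof.
move=> mA; have [_ _ /(_ setT A measurableT mA)] := hZ.
rewrite probability_setT mul1e => <-; congr (P _).
by apply/seteqP; split=> [w ?|w []].
Qed.

Lemma circular_gaussian_re2 :
  (\int[P]_w (complex.Re (Z w) ^+ 2)%:E < +oo)%E.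
Proof.
by apply: (gaussian_second_moment (Y := fun w => complex.Re (Z w)) t0) => //;
  case: hZ.
Qed.

Lemma circular_gaussian_im2 :
  (\int[P]_w (complex.Im (Z w) ^+ 2)%:E < +oo)%E.
Proof.
by apply: (gaussian_second_moment (Y := fun w => complex.Im (Z w)) t0) => //;
  case: hZ.
Qed.

(** Makes the second-hop gain almost surely nonzero, which the positive lower bound on the mean rate
    requires. *)
Lemma circular_gaussian_re_neq0 : P [set w | complex.Re (Z w) != 0] = 1%E.
Proof.
have [mRe _ _] := hZ.
have mRe0 : measurable ((fun w => complex.Re (Z w)) @^-1` [set 0]).
  by rewrite -[X in measurable X]setTI; exact: mRe.
rewrite (_ : [set w | _] = ~` ((fun w => complex.Re (Z w)) @^-1` [set 0])).
  by rewrite probability_setC// law_re// normal_prob_point sube0.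
by apply/seteqP; split=> w /= /eqP.
Qed.

End gaussian.

(** * The sub-layer problem *)

Section link_rate.
Context {R : realType}.
Implicit Types F G : R.

Definition link_rate F G : R := log2 (1 + F * G / (1 + F + G)).

Lemma ln2_gt0 : 0 < ln 2 :> R.
Proof. by rewrite ln_gt0// ltr1n. Qed.

Lemma link_rate_ge0 F G : 0 <= F -> 0 <= G -> 0 <= link_rate F G.
Proof.
move=> F0 G0; rewrite divr_ge0 ?(ltW ln2_gt0)// ln_ge0// lerDl.
by rewrite divr_ge0 ?mulr_ge0// !addr_ge0.
Qed.

(** From ln (1 + x) <= x and FG / (1 + F + G) <= F. The bound is free of the random second-hop
    gain. *)
Lemma link_rate_le F G : 0 <= F -> 0 <= G -> link_rate F G <= F / ln 2.
Proof.
move=> F0 G0; rewrite ler_pM2r ?invr_gt0 ?ln2_gt0//.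
have FG0 : 0 <= F * G / (1 + F + G).
  by rewrite divr_ge0 ?mulr_ge0// !addr_ge0.
apply: (@le_trans _ _ (F * G / (1 + F + G))).
  by apply: le_ln1Dx; rewrite (lt_le_trans _ FG0).
rewrite ler_pdivrMr; last by rewrite !ltr_wpDr.
by rewrite ler_wpM2l// lerDr addr_ge0.
Qed.

(* ln (1 + x) >= x / (1 + x) at x = FG / (1 + F + G) gives the product
   F / (1 + F) * (G / (1 + G)). *)
Lemma link_rate_ge F G : 0 <= F -> 0 <= G ->
  F / (1 + F) * (Num.min G 1 / 2) / ln 2 <= link_rate F G.
Proof.
move=> F0 G0; rewrite ler_pM2r ?invr_gt0 ?ln2_gt0//.
have F1 : 0 < 1 + F by rewrite ltr_wpDr.
have G1 : 0 < 1 + G by rewrite ltr_wpDr.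
have FG1 : 0 < 1 + F + G by rewrite ltr_wpDr.
apply: (@le_trans _ _ (F / (1 + F) * (G / (1 + G)))).
  apply: ler_wpM2l; first by rewrite divr_ge0// ltW.
  rewrite ler_pdivlMr//; have [G1'|G1'] := leP G 1.
    by have := mulr_ge0 G0 (_ : 0 <= 1 - G); rewrite subr_ge0 => /(_ G1'); lra.
  by lra.
have x0 : 0 < 1 + F * G / (1 + F + G).
  by rewrite ltr_wpDr// divr_ge0 ?mulr_ge0// ltW.
have -> : F / (1 + F) * (G / (1 + G)) =
    - ((1 + F * G / (1 + F + G))^-1 - 1).
  by field; rewrite !gt_eqF//= (_ : _ + _ = (1 + F) * (1 + G)) ?mulr_gt0//; ring.
rewrite lerNl -lnV ?posrE// -[X in ln X](subrKC 1) le_ln1Dx//.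
by rewrite ltrBrDl subrr invr_gt0.
Qed.

(** 1 + FG / (1 + F + G) = (1 + F) (1 + G) / (1 + F + G). Without the quotient, measurability
    follows from that of sums and of [ln]. *)
Lemma link_rateE F G : 0 <= F -> 0 <= G ->
  link_rate F G = (ln (1 + F) + ln (1 + G) - ln (1 + F + G)) / ln 2.
Proof.
move=> F0 G0.
have F1 : 0 < 1 + F by rewrite ltr_wpDr.
have G1 : 0 < 1 + G by rewrite ltr_wpDr.
have FG1 : 0 < 1 + F + G by rewrite ltr_wpDr.
rewrite -lnM ?posrE// -ln_div ?posrE ?mulr_gt0//; congr (ln _ / _).
by field; rewrite gt_eqF.
Qed.

End link_rate.

Lemma null_of_integral_eq0 {R : realType} {d} {T : measurableType d}
    (mu : {measure set T -> \bar R}) (f : T -> R) :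
  measurable_fun setT f -> (forall x, 0 <= f x) ->
  (\int[mu]_x (f x)%:E = 0)%E -> mu [set x | 0 < f x] = 0%E.
Proof.
move=> mf f0 If; have mEf : measurable_fun setT (EFin \o f).
  exact/measurable_EFinP.
have : (\int[mu]_x `|(EFin \o f) x| = 0)%E.
  by rewrite -[RHS]If; apply: eq_integral => x _; rewrite /= ger0_norm.
move=> /(ae_eq_integral_abs mu measurableT mEf)[N [mN N0 subN]].
apply: (subset_measure0 _ mN _ N0).
  by rewrite -[X in measurable X]setTI; exact: measurable_fun_ltr.
move=> x /= fx; apply: subN => /= /(_ I) [fx0].
by move: fx; rewrite fx0 ltxx.
Qed.

Section sub_layer_solution.
Context {R : realType} {d} {Omega : measurableType d}.
Variables (Q : probability Omega R) (l : nat) (T tau Ps Pr pr sg2 : R).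
Variables (s : nat -> Omega -> 'I_l.+1) (Kn : nat -> Omega -> nat)
  (g : nat -> 'I_l.+1 -> Omega -> R[i]).
Hypotheses (T0 : 0 < T) (tau0 : 0 < tau) (Ps0 : 0 < Ps) (Pr0 : 0 < Pr)
  (pr0 : 0 < pr).
Hypothesis hsub : sub_layer_model Q pr sg2 s Kn g.

Let I := 'I_l.+1.
Let X : nat -> Omega -> @obs_space R I I := observation s Kn g.
Implicit Types f : 'rV[R[i]]_l.+1.

Let h (x : nat * option (option I)) : (nat + nat + nat * I)%type :=
  match x.2 with
  | None => inl (inl x.1)
  | Some None => inl (inr x.1)
  | Some (Some j) => inr (x.1, j)
  end.

Lemma iid_sub_layer : iid_process Q X.
Proof.
have [hs hK hg hind] := hsub.
apply: (@iid_observation _ _ _ l I _ Q pr sg2 s Kn g _ h hs hK hg hind) => //.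
by move=> [m [[j|]|]] [m' [[j'|]|]]//= [->]// ->.
Qed.

Let mX1 : measurable_fun setT (X 1%N) := iid_sub_layer.1 1%N isT.

Lemma sub_layer_mean_slots : (\int[Q]_w (Kn 1%N w)%:R%:E = (pr^-1)%:E)%E.
Proof.
by have [_ hK _ _] := hsub; exact: (geometric_mean hK pr0).
Qed.

Definition strength f j : R := Ps * Normc.normc (f ord0 j) ^+ 2.

Definition total_strength f : R := \sum_j strength f j.

Definition gain (v : @obs_space R I I) (j : I) : R :=
  Pr * ((v.2 j).1 ^+ 2 + (v.2 j).2 ^+ 2).

Definition rate f (v : @obs_space R I I) : R :=
  link_rate (strength f v.1.1) (gain v v.1.1).

Lemma strength_ge0 f j : 0 <= strength f j.
Proof. by rewrite mulr_ge0 ?sqr_ge0// ltW. Qed.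

Lemma gain_ge0 v j : 0 <= gain v j.
Proof. by rewrite mulr_ge0 ?addr_ge0 ?sqr_ge0// ltW. Qed.

Lemma strength_le f j : strength f j <= total_strength f.
Proof.
rewrite /total_strength (bigD1 j)//= lerDl sumr_ge0// => i _.
exact: strength_ge0.
Qed.

Lemma total_strength_ge0 f : 0 <= total_strength f.
Proof. by apply: sumr_ge0 => j _; exact: strength_ge0. Qed.

Lemma rate_ge0 f v : 0 <= rate f v.
Proof. by apply: link_rate_ge0; [exact: strength_ge0|exact: gain_ge0]. Qed.

Lemma rate_le f v : rate f v <= total_strength f / ln 2.
Proof.
apply: (le_trans (link_rate_le (strength_ge0 _ _) (gain_ge0 _ _))).
by rewrite ler_pM2r ?invr_gt0 ?ln2_gt0// strength_le.
Qed.

Lemma sub_rateE f m w : sub_rate Ps Pr s g f m w = rate f (X m w).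
Proof.
rewrite /sub_rate /rate /link_rate /strength /gain /=.
congr (log2 (1 + _ * (Pr * _) / (1 + _ + Pr * _)));
  by case: (g m (s m w) w) => x y; rewrite /= sqr_sqrtr// addr_ge0 ?sqr_ge0.
Qed.

Lemma measurable_gain j : measurable_fun setT (gain ^~ j).
Proof.
apply: measurable_funM => //; apply: measurable_funD; apply: measurable_funX.
- exact: measurable_gain_re.
- exact: measurable_gain_im.
Qed.

Let measurable_indic_source (j : I) : measurable_fun setT
  (\1_[set v : @obs_space R I I | v.1.1 = j] : @obs_space R I I -> R).
Proof.
apply: measurable_indic; exact: (@measurable_source R I I [set j]).
Qed.

(* The parameter [u] lets the first-hop gains range over any measurable space,
   in particular over the sigma-algebra of the past of the main layer. *)
Lemma measurable_rate {d1} {T1 : measurableType d1} (u : T1 -> 'rV[R[i]]_l.+1) :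
  (forall j, measurable_fun setT (fun t => strength (u t) j)) ->
  measurable_fun setT
    (fun x : T1 * @obs_space R I I => rate (u x.1) x.2).
Proof.
move=> mu.
(* The coordinate read by the rate is itself random; summing over its possible values [j] with
   indicators leaves functions of fixed coordinates. *)
pose r j (x : T1 * @obs_space R I I) := (ln (1 + strength (u x.1) j) +
  ln (1 + gain x.2 j) - ln (1 + strength (u x.1) j + gain x.2 j)) / ln 2.
rewrite (_ : (fun x => _) = (fun x => \sum_j
    (\1_[set v : @obs_space R I I | v.1.1 = j] x.2 * r j x))); last first.
  apply/funext => x; rewrite (bigD1 x.2.1.1)//= big1.
    rewrite addr0 indicE mem_set//= mul1r /rate link_rateE//.
      exact: strength_ge0.
    exact: gain_ge0.
  by move=> j /eqP xj; rewrite indicE memNset ?mul0r//=; apply: nesym.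
apply: measurable_sum => j.
have mS : measurable_fun setT
    (fun x : T1 * @obs_space R I I => strength (u x.1) j).
  exact: (measurableT_comp (mu j) measurable_fst).
have mG : measurable_fun setT (fun x : T1 * @obs_space R I I => gain x.2 j).
  exact: (measurableT_comp (measurable_gain j) measurable_snd).
have mI := measurable_indic_source j.
apply: measurable_funM; first exact: (measurableT_comp mI measurable_snd).
have mln := @measurable_ln R.
apply: measurable_funM => //; apply: measurable_funB; first apply: measurable_funD.
- by apply: (measurableT_comp mln); exact: measurable_funD.
- by apply: (measurableT_comp mln); exact: measurable_funD.
- by apply: (measurableT_comp mln); apply: measurable_funD => //;
    exact: measurable_funD.
Qed.

Lemma measurable_rate1 f : measurable_fun setT (rate f).
Proof.
have mu j : measurable_fun [set: unit] (fun t : unit => strength f j).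
  exact: measurable_cst.
have := @measurable_rate _ unit (fun=> f) mu.
move=> /(measurable_fun_pair2 tt).
exact.
Qed.

Let c := tau / (T * pr).
Let c0 : 0 < c. Proof. by rewrite divr_gt0// mulr_gt0. Qed.

Let ex f x := mean_excess Q (fun w => rate f (X 1%N w)) (fun=> 1) x.

Lemma is_lambda_starP f x :
  is_lambda_star Q T tau Ps Pr pr s g f x <-> 0 <= x /\ ex f x = (x * c)%:E.
Proof.
have exE m : (1 <= m)%N ->
    ('E_Q[fun w => (Num.max (sub_rate Ps Pr s g f m w - x) 0)%R] = ex f x)%E.
  move=> m1; rewrite unlock /ex /mean_excess.
  under eq_integral do rewrite sub_rateE.
  rewrite (@integral_obs _ _ _ _ _ Q X iid_sub_layer m
    (fun v => (Num.max (rate f v - x) 0)%:E))//.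
  - by apply: eq_integral => w _; rewrite mulr1.
  - apply/measurable_EFinP; apply: measurable_maxr => //.
    by apply: measurable_funB => //; exact: measurable_rate1.
  - by move=> v; rewrite lee_fin le_max lexx orbT.
split=> -[x0 xE]; split=> //.
  by rewrite -(exE 1%N)// xE// mulrA.
by move=> m m1; rewrite exE// xE mulrA.
Qed.

Let mrate f : measurable_fun setT (fun w => rate f (X 1%N w)).
Proof. by apply: measurableT_comp => //; exact: measurable_rate1. Qed.

Let mean_rate_lty f : (\int[Q]_w (rate f (X 1%N w))%:E < +oo)%E.
Proof.
apply: (@le_lt_trans _ _ (\int[Q]_w (total_strength f / ln 2)%:E)%E).
  apply: ge0_le_integral => //.
  - by move=> w _; rewrite lee_fin rate_ge0.
  - exact/measurable_EFinP.
  - by move=> w _; rewrite lee_fin rate_le.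
by rewrite integral_cst//= probability_setT mule1 ltry.
Qed.

Let one_lty : (\int[Q]_w (1 : R)%:E < +oo)%E.
Proof. by rewrite integral_cst//= probability_setT mule1 ltry. Qed.

Let lambda := lambda_star Q T tau Ps Pr pr s g.

Lemma lambda_starP f : 0 <= lambda f /\ ex f (lambda f) = (lambda f * c)%:E.
Proof.
apply/is_lambda_starP.
have [x x0 xE] := @excess_equation_exists _ _ _ Q (fun w => rate f (X 1%N w))
  (fun=> 1) c (mrate f) (measurable_cst _) (fun w => rate_ge0 f _)
  (fun=> ler01) (mean_rate_lty f) one_lty c0.
by apply: (@xgetPex _ 0 (is_lambda_star Q T tau Ps Pr pr s g f)); exists x;
  exact/is_lambda_starP.
Qed.

Lemma lambda_star_le f y : (lambda f <= y) = (ex f y <= (y * c)%:E)%E.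
Proof.
have [l0 lE] := lambda_starP f.
exact: (@excess_equation_le _ _ _ Q (fun w => rate f (X 1%N w)) (fun=> 1) c
  (mrate f) (measurable_cst _) (fun w => ler01) c0 _ _ lE).
Qed.

Definition accept f : R :=
  fine (Q [set w | lambda f <= rate f (X 1%N w)]).

Let macc f : measurable [set w | lambda f <= rate f (X 1%N w)].
Proof.
by rewrite -[X in measurable X]setTI; exact: measurable_fun_ler.
Qed.

Let acceptE f : Q [set w | lambda f <= rate f (X 1%N w)] = (accept f)%:E.
Proof. by rewrite /accept fineK// fin_num_measure. Qed.

Lemma accept_le1 f : accept f <= 1.
Proof. by rewrite -lee_fin -acceptE probability_le1. Qed.

Lemma accept_ge0 f : 0 <= accept f.
Proof. by rewrite -lee_fin -acceptE. Qed.

(** The left-hand side is the mean excess of the rate over lambda*. This excess vanishes off the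
    acceptance event and is at most S / ln 2 on it. *)
Lemma lambda_accept f : lambda f * c <= total_strength f / ln 2 * accept f.
Proof.
have [l0 lE] := lambda_starP f.
have S0 : 0 <= total_strength f / ln 2.
  by rewrite divr_ge0 ?total_strength_ge0// ltW// ln2_gt0.
rewrite -lee_fin -lE EFinM -acceptE -integral_cst//.
rewrite [leRHS]integral_mkcond; apply: ge0_le_integral => //.
- by move=> w _; rewrite lee_fin le_max lexx orbT.
- apply/measurable_EFinP; apply: measurable_maxr => //.
  exact: measurable_funB.
- by apply/(measurable_restrictT _ (macc f)); exact: measurable_cst.
move=> w _; rewrite patchE; case: ifPn => [|].
  rewrite inE/= => _; rewrite lee_fin ge_max S0 andbT mulr1.
  by have := rate_le f (X 1%N w); lra.
rewrite notin_setE/= => /negP; rewrite -ltNge => lr.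
by rewrite lee_fin mulr1 ge_max lexx andbT subr_le0 ltW.
Qed.

Lemma lambda_le f : lambda f * c <= total_strength f / ln 2.
Proof.
apply: (le_trans (lambda_accept f)); rewrite ler_piMr ?accept_le1//.
by rewrite divr_ge0 ?total_strength_ge0// ltW// ln2_gt0.
Qed.

Lemma accept_lambda0 f : lambda f = 0 -> accept f = 1.
Proof.
move=> l0; rewrite /accept l0 (_ : [set w | _] = setT) ?probability_setT//.
by apply/seteqP; split=> // w _ /=; exact: rate_ge0.
Qed.

Lemma accept_gt0 f : 0 < accept f.
Proof.
have [l0 _] := lambda_starP f; move: l0; rewrite le_eqVlt => /predU1P[l0|l0].
  by rewrite accept_lambda0.
rewrite lt_neqAle accept_ge0 andbT; apply/eqP => a0.
have := lambda_accept f; rewrite -a0 mulr0 leNgt => /negP; apply.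
by rewrite mulr_gt0.
Qed.

(** Mean over source [j] of the factor of [link_rate_ge] that does not depend on the first-hop
    gains. *)
Let mean_quality j : \bar R :=
  (\int[Q]_w (\1_[set v : @obs_space R I I | v.1.1 = j] (X 1%N w) *
     (Num.min (gain (X 1%N w) j) 1 / 2))%:E)%E.

Let mquality j : measurable_fun setT (fun w =>
  \1_[set v : @obs_space R I I | v.1.1 = j] (X 1%N w) *
     (Num.min (gain (X 1%N w) j) 1 / 2)).
Proof.
have mI := measurable_indic_source j.
apply: measurable_funM; first exact: (measurableT_comp mI mX1).
apply: measurable_funM => //; apply: measurable_minr => //.
exact: (measurableT_comp (measurable_gain j) mX1).
Qed.

Let quality_ge0 j w : 0 <= \1_[set v : @obs_space R I I | v.1.1 = j] (X 1%N w) *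
     (Num.min (gain (X 1%N w) j) 1 / 2) :> R.
Proof. by rewrite mulr_ge0 ?indicE ?ler0n// divr_ge0// le_min gain_ge0 ler01. Qed.

(** Were it 0, the event of selecting [j], which has positive probability, would be covered by two
    null sets: positive quality, and a vanishing real part of the gain. *)
Let mean_quality_gt0 j : (0 < mean_quality j)%E.
Proof.
have [hs _ hg _] := hsub.
rewrite lt0e integral_ge0 ?andbT; last by move=> w _; rewrite lee_fin.
apply/eqP => E0; have := null_of_integral_eq0 (mquality j) (quality_ge0 j) E0.
set A := [set w | _] => PA0.
have mA : measurable A.
  by rewrite -[X in measurable X]setTI; exact: measurable_fun_ltr.
have [mRe _ _] := hg 1%N j isT.
have mB : measurable [set w | complex.Re (g 1%N j w) != 0].
  rewrite (_ : [set w | _] = ~` ((fun w => complex.Re (g 1%N j w)) @^-1` [set 0])).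
    by apply: measurableC; rewrite -[X in measurable X]setTI; exact: mRe.
  by apply/seteqP; split=> w /= /eqP.
have PB0 : Q (~` [set w | complex.Re (g 1%N j w) != 0]) = 0%E.
  rewrite probability_setC// (circular_gaussian_re_neq0 (hg 1%N j isT)).
  by rewrite subee.
have [msj Psj] := hs 1%N isT j.
have sub : s 1%N @^-1` [set j] `<=` A `|` ~` [set w | complex.Re (g 1%N j w) != 0].
  move=> w /= sw; have [Re0|Re0] := pselect (complex.Re (g 1%N j w) != 0).
    left; rewrite /A /= indicE mem_set//= mul1r divr_gt0// lt_min ltr01 andbT.
    rewrite mulr_gt0// ltr_wpDr ?sqr_ge0// exprn_even_gt0//.
  by right.
have : (Q (s 1%N @^-1` [set j]) <= 0)%E.
  apply: (le_trans (le_measure _ _ _ sub)); rewrite ?inE//.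
    by apply: measurableU => //; exact: measurableC.
  apply: (le_trans (measureU2 _ mA (measurableC mB))).
  by rewrite [X in (X + _)%E]PA0 [X in (_ + X)%E]PB0 adde0.
apply/negP; rewrite -ltNge [ltRHS]Psj lte_fin invr_gt0 ltr0n.
by [].
Qed.

Let mean_quality_fin j : mean_quality j \is a fin_num.
Proof.
rewrite ge0_fin_numE; last exact: ltW (mean_quality_gt0 j).
apply: le_lt_trans one_lty; apply: ge0_le_integral => //.
- by move=> w _; rewrite lee_fin.
- exact/measurable_EFinP.
move=> w _; rewrite lee_fin -[leRHS]mul1r ler_pM//.
  by rewrite divr_ge0// le_min gain_ge0 ler01.
have : Num.min (gain (X 1%N w) j) 1 <= 1 by rewrite ge_min lexx orbT.
by lra.
Qed.

(** A positive lower bound for all the mean qualities, obtained without choosing a minimal one. *)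
Let kappa : R := (\sum_j (fine (mean_quality j))^-1)^-1.

Let fine_quality_gt0 j : 0 < fine (mean_quality j).
Proof. by rewrite -lte_fin fineK ?mean_quality_gt0. Qed.

Let sum_inv_ge j : (fine (mean_quality j))^-1 <= \sum_i (fine (mean_quality i))^-1.
Proof.
rewrite [leRHS](bigD1 j)//= lerDl sumr_ge0// => i _.
by rewrite invr_ge0 ltW.
Qed.

Let kappa_gt0 : 0 < kappa.
Proof.
rewrite invr_gt0; apply: lt_le_trans (sum_inv_ge ord0).
by rewrite invr_gt0.
Qed.

Let kappa_le j : kappa <= fine (mean_quality j).
Proof.
by rewrite -[leRHS]invrK lef_pV2 ?sum_inv_ge// posrE ?invr_gt0//
  -[ltRHS]invrK invr_gt0.
Qed.

(** In [link_rate_ge] the first factor F_j / (1 + F_j) is at least F_j / (1 + S), because F_j <= S.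
    The denominators then agree, and the sum over the sources produces S / (1 + S). *)
Let mean_rate_ge f :
  ((kappa * total_strength f / ((1 + total_strength f) * ln 2))%:E <=
   \int[Q]_w (rate f (X 1%N w))%:E)%E.
Proof.
set S := total_strength f.
have S1 : 0 < 1 + S by rewrite ltr_wpDr// total_strength_ge0.
pose a j := strength f j / ((1 + S) * ln 2).
have a0 j : 0 <= a j.
  by rewrite divr_ge0 ?strength_ge0// mulr_ge0// ltW// ln2_gt0.
pose b j w : R := \1_[set v : @obs_space R I I | v.1.1 = j] (X 1%N w) *
     (Num.min (gain (X 1%N w) j) 1 / 2).
apply: (@le_trans _ _ (\sum_j ((a j)%:E * mean_quality j)%E)%R).
  rewrite (_ : kappa * S / ((1 + S) * ln 2) = \sum_j a j * kappa); last first.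
    by rewrite -!mulr_suml -/(total_strength f) -/S -mulrA mulrC.
  rewrite -sumEFin; apply: lee_sum => j _.
  by rewrite -(fineK (mean_quality_fin j)) -EFinM lee_fin ler_wpM2l.
rewrite (_ : (\sum_j _)%R = \int[Q]_w (\sum_j (a j)%:E * (b j w)%:E)%E)%E.
  apply: ge0_le_integral => //.
  - by move=> w _; apply: sume_ge0 => j _; rewrite mule_ge0// lee_fin// quality_ge0.
  - apply: emeasurable_sum => j; apply: emeasurable_funM => //.
    by apply/measurable_EFinP; exact: mquality.
  - exact/measurable_EFinP.
  move=> w _; rewrite (bigD1 (X 1%N w).1.1)//= big1 ?adde0; last first.
    move=> j /eqP xj; rewrite /b indicE memNset ?mul0r ?mule0//=.
    exact: nesym.
  rewrite /b indicE mem_set//= mul1r lee_fin.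
  apply: le_trans (link_rate_ge (strength_ge0 _ _) (gain_ge0 _ _)).
  set j := (X 1%N w).1.1; set m := Num.min _ 1 / 2.
  have -> : a j * m = strength f j / (1 + S) * m / ln 2.
    by rewrite /a invfM (mulrA (strength f j)) (mulrAC _ _ m).
  rewrite ler_pM2r ?invr_gt0 ?ln2_gt0//.
  apply: ler_wpM2r; first by rewrite divr_ge0// le_min gain_ge0 ler01.
  apply: ler_wpM2l; first exact: strength_ge0.
  rewrite lef_pV2 ?posrE// ?lerD2l ?strength_le//.
  by rewrite ltr_wpDr// strength_ge0.
rewrite ge0_integral_sum//; last 2 first.
- move=> j; apply: emeasurable_funM => //.
  by apply/measurable_EFinP; exact: mquality.
- by move=> j w _; rewrite mule_ge0// lee_fin// quality_ge0.
apply: eq_bigr => j _; rewrite ge0_integralZl//.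
- by apply/measurable_EFinP; exact: mquality.
- by move=> w _; rewrite lee_fin quality_ge0.
- by rewrite lee_fin.
Qed.

(** Lowering the threshold from lambda* to 0 raises the mean excess by at most lambda*, so E R^f <=
    lambda* c + lambda*. *)
Let lambda_ge f : kappa * total_strength f / ((1 + total_strength f) * ln 2) <=
  lambda f * (1 + c).
Proof.
have [l0 lE] := lambda_starP f.
have := @mean_excess_lip _ _ _ Q (fun w => rate f (X 1%N w)) (fun=> 1)
  (mrate f) (measurable_cst _) (fun=> ler01) 0 (lambda f).
rewrite mean_excess0; last by move=> w; exact: rate_ge0.
rewrite [mean_excess _ _ _ _]lE integral_cst//= probability_setT mule1 mule1.
rewrite sub0r normrN ger0_norm// -EFinD => /(le_trans (mean_rate_ge f)).
by rewrite lee_fin mulrDr mulr1 [X in _ <= X]addrC.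
Qed.

(** For S > 0 the upper and lower bounds on lambda* combine and the factor S cancels, leaving (1 +
    c) (1 + S) / (c kappa). For S = 0, lambda* = 0 and every rate is accepted; the leading 1 of the
    constant covers this case. *)
Let inv_accept_le f : (accept f)^-1 <=
  (1 + (1 + c) / (c * kappa)) * (1 + total_strength f).
Proof.
set S := total_strength f; have S0 : 0 <= S by exact: total_strength_ge0.
have S1 : 0 < 1 + S by rewrite ltr_wpDr.
have c1 : 0 < 1 + c by rewrite addr_gt0.
have ck : 0 < c * kappa by rewrite mulr_gt0.
have C0 : 0 <= (1 + c) / (c * kappa) by rewrite divr_ge0// ltW.
have q0 := accept_gt0 f.
have [Sp|] := ltP 0 S; last first.
  move=> Sn; have S00 : S = 0 by apply/le_anti; rewrite Sn S0.
  rewrite accept_lambda0 ?invr1 -/S ?S00 ?addr0 ?mulr1 ?lerDl//.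
  have := lambda_le f; rewrite -/S S00 mul0r pmulr_lle0//.
  by case: (lambda_starP f) => l0 _ ln; apply/le_anti; rewrite ln l0.
apply: (@le_trans _ _ ((1 + c) / (c * kappa) * (1 + S))); last first.
  by rewrite ler_wpM2r ?(ltW S1)// lerDr.
have h1 := lambda_accept f; have h2 := lambda_ge f.
have : kappa * S / ((1 + S) * ln 2) * c <= S / ln 2 * accept f * (1 + c).
  apply: (le_trans (ler_wpM2r (ltW c0) h2)).
  by rewrite mulrAC ler_wpM2r ?(ltW c1).
rewrite (_ : _ * c = S / ln 2 * (kappa * c / (1 + S))); last first.
  by field; rewrite !gt_eqF ?ln2_gt0.
rewrite -[leRHS]mulrA ler_pM2l; last by rewrite divr_gt0 ?ln2_gt0.
rewrite ler_pdivrMr// => hk; rewrite -div1r ler_pdivrMr//.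
rewrite (_ : _ * accept f = accept f * (1 + c) * (1 + S) / (c * kappa)).
  by rewrite ler_pdivlMr// mul1r mulrC.
by field; rewrite !gt_eqF.
Qed.

Definition mean_sojourn f : R := T / 2 + tau / (2 * pr) / accept f.

Lemma mean_sojourn_ge0 f : 0 <= mean_sojourn f.
Proof.
have q0 := accept_gt0 f.
by rewrite addr_ge0 ?divr_ge0 ?mulr_ge0// ltW.
Qed.

Lemma T_barE f : T_bar Q T tau Ps Pr pr s Kn g f = (mean_sojourn f)%:E.
Proof.
pose A v := lambda f <= rate f v.
have mA : measurable [set v | A v].
  rewrite -[X in measurable X]setTI; apply: measurable_fun_ler => //.
  exact: measurable_rate1.
pose N w := first_time (fun m => A (X m w)).
(* The sub-layer is treated as a main layer whose observations have second-hop duration 0. *)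
have -> : T_bar Q T tau Ps Pr pr s Kn g f =
    mean_duration Q T tau (fun m w => (X m w).1.2) (fun _ _ => 0%E) N.
  apply: eq_integral => w _.
  have -> : M_star Q T tau Ps Pr pr s g f = N.
    apply/funext => w'; congr first_time; apply/funext => m.
    by rewrite sub_rateE.
  by rewrite /at_time; case: (N w) => // m; rewrite add0e.
have sN : stopping X N by exact: first_time_stopping.
have q0 := accept_gt0 f.
have N0 : Q [set w | N w = None] = 0%E by exact: (first_time_finite iid_sub_layer).
rewrite (@mean_duration_split _ _ _ _ _ Q X iid_sub_layer T tau pr
  (fun v => v.1.2) (fun=> 0) T0 tau0 (@measurable_slots R I I)
  (measurable_cst _) (fun=> lexx _) sub_layer_mean_slots N sN N0).
rewrite (mean_time_first_time iid_sub_layer mA q0).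
rewrite (@ge0_integral_at_time_eq _ _ _ _ _ Q X iid_sub_layer N +oo%E _
  (fun=> (T / 2)%:E) sN N0)//; last 3 first.
- by move=> m w _; rewrite lee_fin add0r divr_ge0// ltW.
- by move=> w; rewrite lee_fin divr_ge0// ltW.
- by move=> m w _; rewrite add0r.
rewrite integral_cst//= probability_setT mule1 -EFinM -EFinD /mean_sojourn.
by rewrite (mulrC _^-1).
Qed.

Lemma mean_sojourn_le : exists2 C, 0 <= C &
  forall f, mean_sojourn f <= C * (1 + total_strength f).
Proof.
have ck : 0 < c * kappa by rewrite mulr_gt0.
have c1 : 0 < 1 + c by rewrite addr_gt0.
have C0 : 0 <= 1 + (1 + c) / (c * kappa) by rewrite addr_ge0// divr_ge0// ltW.
have t0 : 0 <= tau / (2 * pr) by rewrite divr_ge0 ?mulr_ge0// ltW.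
have T20 : 0 <= T / 2 by rewrite divr_ge0// ltW.
exists (T / 2 + tau / (2 * pr) * (1 + (1 + c) / (c * kappa))).
  by rewrite addr_ge0// mulr_ge0.
move=> f; rewrite mulrDl; apply: lerD.
  by rewrite ler_peMr ?lerDl ?total_strength_ge0.
by rewrite -[leRHS]mulrA ler_wpM2l// inv_accept_le.
Qed.

(** Separate bounds on lambda* and on 1 / q would multiply to order S^2. Since [lambda_accept]
    bounds the quotient lambda* / q by S / (c ln 2), the reward is linear in S, and second moments
    of the gains suffice. *)
Lemma reward_le f :
  lambda f * mean_sojourn f <= (T / (2 * c) + tau / (2 * pr * c)) / ln 2 *
    total_strength f.
Proof.
have q0 := accept_gt0 f.
have h1 := lambda_accept f; have h2 := lambda_le f.
have t0 : 0 < tau / (2 * pr) by rewrite divr_gt0 ?mulr_gt0.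
have e1 : lambda f * (T / 2) <= total_strength f / ln 2 / c * (T / 2).
  by rewrite ler_wpM2r ?divr_ge0 ?(ltW T0)// ler_pdivlMr.
have e2 : lambda f / accept f * (tau / (2 * pr)) <=
    total_strength f / ln 2 / c * (tau / (2 * pr)).
  rewrite ler_wpM2r ?(ltW t0)// ler_pdivrMr//.
  by rewrite mulrAC ler_pdivlMr.
rewrite /mean_sojourn mulrDr.
have -> : lambda f * (tau / (2 * pr) / accept f) =
    lambda f / accept f * (tau / (2 * pr)) by rewrite mulrCA mulrC.
apply: (le_trans (lerD e1 e2)); rewrite le_eqVlt; apply/orP; left; apply/eqP.
by field; rewrite !gt_eqF ?ln2_gt0.
Qed.

Section measurable_solution.
Context {d1} {T1 : measurableType d1} (u : T1 -> 'rV[R[i]]_l.+1).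
Hypothesis mu : forall j, measurable_fun setT (fun t => strength (u t) j).

Let mrateX : measurable_fun setT
  (fun x : T1 * Omega => rate (u x.1) (X 1%N x.2)).
Proof.
apply: (measurableT_comp (measurable_rate mu)
  (g := fun x : T1 * Omega => (x.1, X 1%N x.2))).
apply: measurable_fun_pair; first exact: measurable_fst.
exact: (measurableT_comp mX1 measurable_snd).
Qed.

(** By [lambda_star_le], lambda* > y is a strict inequality on the mean excess at the fixed level y,
    and that mean is measurable in the parameter by Fubini-Tonelli. *)
Lemma measurable_lambda_star : measurable_fun setT (fun t => lambda (u t)).
Proof.
apply: (measurability _ (RGenOInfty.measurableE R)).
move=> _ [_ [y ->] <-]; rewrite setTI.
have mex : measurable_fun setT (fun t => ex (u t) y).
  apply: (@measurable_fun_fubini_tonelli_F _ _ T1 Omega R Q (fun x : T1 * Omega =>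
    (Num.max (rate (u x.1) (X 1%N x.2) - y * 1) 0)%:E)).
    apply/measurable_EFinP; apply: measurable_maxr => //.
    exact: measurable_funB.
  by move=> x; rewrite lee_fin le_max lexx orbT.
rewrite (_ : _ @^-1` _ = [set t | ((y * c)%:E < ex (u t) y)%E]).
  rewrite -[X in measurable X]setTI; exact: emeasurable_fun_o_infty.
apply/seteqP; split=> t /=; rewrite in_itv/= andbT !ltNge; apply: contra;
  by rewrite lambda_star_le.
Qed.

Let measurable_accept : measurable_fun setT (fun t => accept (u t)).
Proof.
pose A : set (T1 * Omega) :=
  [set x | lambda (u x.1) <= rate (u x.1) (X 1%N x.2)].
have mA : measurable A.
  rewrite -[X in measurable X]setTI; apply: measurable_fun_ler => //.
  exact: (measurableT_comp measurable_lambda_star measurable_fst).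
have mQ := measurable_fun_xsection Q mA.
have -> : (fun t => accept (u t)) = fine \o (fun t => Q (xsection A t)).
  apply/funext => t; rewrite /accept /=; congr (fine (Q _)).
  by apply/seteqP; split=> w; rewrite /xsection/= ?inE.
exact: (measurableT_comp (fine_measurable measurableT) mQ).
Qed.

Lemma measurable_mean_sojourn : measurable_fun setT (fun t => mean_sojourn (u t)).
Proof.
apply: measurable_funD => //; apply: measurable_funM => //.
(* Positivity of [accept] lets its reciprocal be written as a composition of measurable
   functions. *)
rewrite (_ : (fun t => _) = (fun t => expR (- ln (accept (u t))))); last first.
  by apply/funext => t; rewrite expRN lnK// posrE accept_gt0.
apply: (measurableT_comp (@measurable_expR R)); apply: measurable_funN.
exact: (measurableT_comp (@measurable_ln R) measurable_accept).
Qed.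

End measurable_solution.

End sub_layer_solution.

(** * The main-layer problem *)

Lemma first_time_SomeP (A : pred nat) n :
  first_time A = Some n <->
  [/\ (1 <= n)%N, A n & forall i, (1 <= i < n)%N -> ~~ A i].
Proof.
have := first_timeP A; split=> [E|[n1 An nmin]].
  by rewrite E in H *.
case: (first_time A) H => [m [m1 Am mmin]|/(_ n n1)]; last by rewrite An.
congr Some; apply/eqP; rewrite eqn_leq; apply/andP; split.
  by rewrite leqNgt; apply/negP => nm; have := mmin n; rewrite n1 nm An => /(_ isT).
by rewrite leqNgt; apply/negP => mn; have := nmin m; rewrite m1 mn Am => /(_ isT).
Qed.

Section main_layer_solution.
Context {R : realType} {k l : nat}.
Variables (T tau Ps Pr pr sf2 sg2 ps : R).
Hypotheses (T0 : 0 < T) (tau0 : 0 < tau) (Ps0 : 0 < Ps) (Pr0 : 0 < Pr)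
  (sf20 : 0 < sf2) (ps0 : 0 < ps) (pr0 : 0 < pr).
Context {d} {Omega : measurableType d} (P : probability Omega R).
Variables (s : nat -> Omega -> 'I_k.+1) (Kn : nat -> Omega -> nat)
  (f : nat -> 'I_k.+1 -> 'I_l.+1 -> Omega -> R[i]).
Hypothesis hmain : main_layer_model P ps sf2 s Kn f.
Context {d'} {Omega' : measurableType d'} (Q : probability Omega' R).
Variables (s' : nat -> Omega' -> 'I_l.+1) (K' : nat -> Omega' -> nat)
  (g : nat -> 'I_l.+1 -> Omega' -> R[i]).
Hypothesis hsub : sub_layer_model Q pr sg2 s' K' g.

Let J := ('I_k.+1 * 'I_l.+1)%type.
Let V := @obs_space R 'I_k.+1 J.
Let X : nat -> Omega -> V := observation s Kn (fun n (ij : J) => f n ij.1 ij.2).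

Let h (x : nat * option (option J)) : (nat + nat + nat * 'I_k.+1 * 'I_l.+1)%type :=
  match x.2 with
  | None => inl (inl x.1)
  | Some None => inl (inr x.1)
  | Some (Some ij) => inr (x.1, ij.1, ij.2)
  end.

Lemma iid_main_layer : iid_process P X.
Proof.
have [hs hK hf hind] := hmain.
apply: (@iid_observation _ _ _ k J _ P ps sf2 s Kn
  (fun n (ij : J) => f n ij.1 ij.2) _ h hs hK _ hind) => //.
- by move=> m ij m1; exact: hf.
- by move=> [m [[[i j]|]|]] [m' [[[i' j']|]|]]//= [->]// -> ->.
Qed.

Let mX1 : measurable_fun setT (X 1%N) := iid_main_layer.1 1%N isT.

Lemma main_layer_mean_slots : (\int[P]_w (Kn 1%N w)%:R%:E = (ps^-1)%:E)%E.
Proof. by have [_ hK _ _] := hmain; exact: (geometric_mean hK ps0). Qed.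

Let hop_re j (v : V) : R := (v.2 (v.1.1, j)).1.
Let hop_im j (v : V) : R := (v.2 (v.1.1, j)).2.

Let measurable_at_source (F : J -> V -> R) j :
  (forall ij, measurable_fun setT (F ij)) ->
  measurable_fun setT (fun v : V => F (v.1.1, j) v).
Proof.
move=> mF; rewrite (_ : (fun v => _) = (fun v : V => \sum_i
    (\1_[set v : V | v.1.1 = i] v * F (i, j) v))); last first.
  apply/funext => v; rewrite (bigD1 v.1.1)//= big1.
    by rewrite addr0 indicE mem_set//= mul1r.
  by move=> i /eqP vi; rewrite indicE memNset ?mul0r//=; apply: nesym.
apply: measurable_sum => i; apply: measurable_funM => //.
apply: measurable_indic; exact: (@measurable_source R 'I_k.+1 J [set i]).
Qed.

Let measurable_hop_re j : measurable_fun setT (hop_re j).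
Proof.
apply: (measurable_at_source (F := fun ij v => (v.2 ij).1)) => ij.
exact: measurable_gain_re.
Qed.

Let measurable_hop_im j : measurable_fun setT (hop_im j).
Proof.
apply: (measurable_at_source (F := fun ij v => (v.2 ij).2)) => ij.
exact: measurable_gain_im.
Qed.

Let hop (v : V) : 'rV[R[i]]_l.+1 := \row_j Complex (hop_re j v) (hop_im j v).

Lemma first_hopE n w : first_hop s f n w = hop (X n w).
Proof.
apply/rowP => j; rewrite !mxE /hop_re /hop_im /=.
by case: (f n (s n w) j w).
Qed.

Let strength_re_im (u : 'rV[R[i]]_l.+1) j : strength Ps u j =
  Ps * (complex.Re (u ord0 j) ^+ 2 + complex.Im (u ord0 j) ^+ 2).
Proof.
rewrite /strength; case: (u ord0 j) => x y /=.
by rewrite sqr_sqrtr// addr_ge0 ?sqr_ge0.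
Qed.

Let measurable_strength j : measurable_fun setT (fun v => strength Ps (hop v) j).
Proof.
rewrite (_ : (fun v => _) =
    (fun v => Ps * (hop_re j v ^+ 2 + hop_im j v ^+ 2))); last first.
  by apply/funext => v; rewrite strength_re_im mxE.
by apply: measurable_funM => //; apply: measurable_funD; apply: measurable_funX.
Qed.

Let lambda := lambda_star Q T tau Ps Pr pr s' g.
Let sojourn := mean_sojourn Q T tau Ps Pr pr s' K' g.
Let rho1 (v : V) : R := lambda (hop v) * sojourn (hop v).
Let rho2 (v : V) : R := sojourn (hop v).
Let Tbar := T_bar Q T tau Ps Pr pr s' K' g.
Let R1 n w := ((lambda (first_hop s f n w))%:E * Tbar (first_hop s f n w))%E.
Let R2 n w := Tbar (first_hop s f n w).

Let TbarE u : Tbar u = (sojourn u)%:E.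
Proof. exact: (T_barE T0 tau0 Ps0 Pr0 pr0 hsub). Qed.

Let R1E : R1 = fun n w => (rho1 (X n w))%:E.
Proof. by apply/funext => n; apply/funext => w; rewrite /R1 TbarE first_hopE. Qed.

Let R2E : R2 = fun n w => (rho2 (X n w))%:E.
Proof. by apply/funext => n; apply/funext => w; rewrite /R2 TbarE first_hopE. Qed.

Let lambda_ge0 u : 0 <= lambda u.
Proof. by have [] := lambda_starP T0 tau0 Ps0 Pr0 pr0 hsub u. Qed.

Let rho2_ge0 v : 0 <= rho2 v.
Proof. exact: (mean_sojourn_ge0 T0 tau0 Ps0 Pr0 pr0 hsub). Qed.

Let rho1_ge0 v : 0 <= rho1 v.
Proof. exact: mulr_ge0 (lambda_ge0 _) (rho2_ge0 _). Qed.

Let mrho2 : measurable_fun setT rho2.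
Proof. exact: (measurable_mean_sojourn T0 tau0 Ps0 Pr0 pr0 hsub). Qed.

Let mrho1 : measurable_fun setT rho1.
Proof.
apply: measurable_funM => //.
exact: (measurable_lambda_star T0 tau0 Ps0 Pr0 pr0 hsub).
Qed.

Let measurable_total : measurable_fun setT (fun v => total_strength Ps (hop v)).
Proof. exact: measurable_sum. Qed.

(** Bounding the row of the selected source by the sum over all rows removes the random index and
    leaves finitely many Gaussian second moments. *)
Let mean_total_lty : (\int[P]_w (total_strength Ps (hop (X 1%N w)))%:E < +oo)%E.
Proof.
have [_ _ hf _] := hmain.
pose E2 (ij : J) w := Ps * (complex.Re (f 1%N ij.1 ij.2 w) ^+ 2 +
  complex.Im (f 1%N ij.1 ij.2 w) ^+ 2).
have mRe2 ij : measurable_fun setT (fun w => complex.Re (f 1%N ij.1 ij.2 w) ^+ 2).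
  by apply: measurable_funX; have [] := hf 1%N ij.1 ij.2 isT.
have mIm2 ij : measurable_fun setT (fun w => complex.Im (f 1%N ij.1 ij.2 w) ^+ 2).
  by apply: measurable_funX; have [] := hf 1%N ij.1 ij.2 isT.
have mE2 ij : measurable_fun setT (E2 ij).
  by apply: measurable_funM => //; exact: measurable_funD.
have E20 ij w : 0 <= E2 ij w by rewrite mulr_ge0 ?addr_ge0 ?sqr_ge0// ltW.
have E2oo ij : (\int[P]_w (E2 ij w)%:E < +oo)%E.
  under eq_integral do rewrite EFinM.
  rewrite ge0_integralZl//; last 3 first.
  - by apply/measurable_EFinP; exact: measurable_funD.
  - by move=> w _; rewrite lee_fin addr_ge0 ?sqr_ge0.
  - by rewrite lee_fin ltW.
  under eq_integral do rewrite EFinD.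
  rewrite lte_mul_pinfty// ?lee_fin ?ltW// ge0_integralD//; last 4 first.
  - by move=> w _; rewrite lee_fin sqr_ge0.
  - exact/measurable_EFinP.
  - by move=> w _; rewrite lee_fin sqr_ge0.
  - exact/measurable_EFinP.
  apply: lte_add_pinfty.
    exact: (circular_gaussian_re2 sf20 (hf 1%N ij.1 ij.2 isT)).
  exact: (circular_gaussian_im2 sf20 (hf 1%N ij.1 ij.2 isT)).
apply: (@le_lt_trans _ _ (\int[P]_w (\sum_ij (E2 ij w)%:E)%E)%E).
  apply: ge0_le_integral => //.
  - by move=> w _; rewrite lee_fin sumr_ge0// => j _; exact: strength_ge0.
  - by apply/measurable_EFinP; exact: (measurableT_comp measurable_total mX1).
  - by apply: emeasurable_sum => ij; exact/measurable_EFinP.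
  move=> w _; rewrite sumEFin lee_fin.
  rewrite [leRHS](_ : _ = \sum_i \sum_j E2 (i, j) w); last first.
    by rewrite pair_bigA; apply: eq_bigr => -[].
  rewrite (bigD1 (s 1%N w))//= ler_wpDr//.
    by apply: sumr_ge0 => i _; exact: sumr_ge0.
  by apply: ler_sum => j _; rewrite strength_re_im mxE.
rewrite ge0_integral_sum//; last 2 first.
- by move=> ij; exact/measurable_EFinP.
- by move=> ij w _; rewrite lee_fin.
by apply: lte_sum_pinfty => ij _; exact: E2oo.
Qed.

(** Dominates [rho2] with D = 1 and [rho1] with D = 0. *)
Let mean_affine_lty (C D : R) : 0 <= C -> 0 <= D ->
  (\int[P]_w (C * (D + total_strength Ps (hop (X 1%N w))))%:E < +oo)%E.
Proof.
move=> C0 D0.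
have S0 w : 0 <= total_strength Ps (hop (X 1%N w)).
  by apply: sumr_ge0 => j _; exact: strength_ge0.
have mS : measurable_fun setT (fun w => total_strength Ps (hop (X 1%N w))).
  exact: (measurableT_comp measurable_total mX1).
under eq_integral do rewrite EFinM.
rewrite ge0_integralZl//; last 2 first.
- by apply/measurable_EFinP; exact: measurable_funD.
- by move=> w _; rewrite lee_fin addr_ge0.
rewrite lte_mul_pinfty//.
under eq_integral do rewrite EFinD.
rewrite ge0_integralD//; last 2 first.
- by move=> w _; rewrite lee_fin.
- exact/measurable_EFinP.
by rewrite lte_add_pinfty// integral_cst//= probability_setT mule1 ltry.
Qed.

Let mean_rho2 : (\int[P]_w (rho2 (X 1%N w))%:E < +oo)%E.
Proof.
have [C C0 CE] := mean_sojourn_le T0 tau0 Ps0 Pr0 pr0 hsub.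
apply: le_lt_trans (mean_affine_lty C0 ler01); apply: ge0_le_integral => //.
- by move=> w _; rewrite lee_fin.
- by apply/measurable_EFinP; exact: (measurableT_comp mrho2 mX1).
- apply/measurable_EFinP; apply: measurable_funM => //; apply: measurable_funD => //.
  exact: (measurableT_comp measurable_total mX1).
- by move=> w _; rewrite lee_fin; exact: CE.
Qed.

Let mean_rho1 : (\int[P]_w (rho1 (X 1%N w))%:E < +oo)%E.
Proof.
have := reward_le T0 tau0 Ps0 Pr0 pr0 hsub; set C := _ / ln 2 => CE.
have C0 : 0 <= C.
  rewrite /C ltW// divr_gt0 ?ln2_gt0//.
  have c0 : 0 < tau / (T * pr) by rewrite divr_gt0// mulr_gt0.
  by apply: addr_gt0; apply: divr_gt0 => //; apply: mulr_gt0 => //;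
    exact: mulr_gt0.
apply: le_lt_trans (mean_affine_lty C0 (lexx 0)); apply: ge0_le_integral => //.
- by move=> w _; rewrite lee_fin.
- by apply/measurable_EFinP; exact: (measurableT_comp mrho1 mX1).
- apply/measurable_EFinP; apply: measurable_funM => //; apply: measurable_funD => //.
  exact: (measurableT_comp measurable_total mX1).
- by move=> w _; rewrite lee_fin add0r; exact: CE.
Qed.

Let excess gamma v : R :=
  Num.max (rho1 v - gamma * rho2 v - gamma * (T / 2)) 0.

Let is_gamma_starE gamma :
  is_gamma_star P T tau ps R1 R2 gamma <->
  (\int[P]_w (excess gamma (X 1%N w))%:E = (gamma * tau / (2 * ps))%:E)%E.
Proof.
have exE n : (1 <= n)%N ->
    (\int[P]_w maxe (R1 n w - gamma%:E * R2 n w - (gamma * (T / 2))%:E) 0 =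
     \int[P]_w (excess gamma (X 1%N w))%:E)%E.
  move=> n1; rewrite R1E R2E.
  rewrite -(@integral_obs _ _ _ _ _ P X iid_main_layer n
    (fun v => (excess gamma v)%:E))//.
  - by apply: eq_integral => w _; rewrite /excess EFin_max.
  - apply/measurable_EFinP; apply: measurable_maxr => //.
    by do 2 apply: measurable_funB => //; exact: measurable_funM.
  - by move=> v; rewrite lee_fin le_max lexx orbT.
split=> [/(_ 1%N isT)|E n n1]; first by rewrite exE.
by rewrite exE.
Qed.

Lemma is_gamma_star_exists : exists gamma, is_gamma_star P T tau ps R1 R2 gamma.
Proof.
have c0 : 0 < tau / (2 * ps) by rewrite divr_gt0// mulr_gt0.
have mb : measurable_fun setT (fun w => rho2 (X 1%N w) + T / 2).
  by apply: measurable_funD => //; exact: (measurableT_comp mrho2 mX1).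
have T20 : 0 <= T / 2 by rewrite divr_ge0// ltW.
have boo : (\int[P]_w (rho2 (X 1%N w) + T / 2)%:E < +oo)%E.
  under eq_integral do rewrite EFinD.
  rewrite ge0_integralD//; last 2 first.
  - by move=> w _; rewrite lee_fin.
  - by apply/measurable_EFinP; exact: (measurableT_comp mrho2 mX1).
  by rewrite lte_add_pinfty// integral_cst//= probability_setT mule1 ltry.
have [gamma _ gE] := @excess_equation_exists _ _ _ P
  (fun w => rho1 (X 1%N w)) (fun w => rho2 (X 1%N w) + T / 2) _
  (measurableT_comp mrho1 mX1) mb (fun w => rho1_ge0 _)
  (fun w => addr_ge0 (rho2_ge0 _) T20) mean_rho1 boo c0.
exists gamma; apply/is_gamma_starE; rewrite -mulrA -gE.
apply: eq_integral => w _; congr (Num.max _ _)%:E.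
by rewrite [in RHS](mulrDr gamma) opprD addrA.
Qed.

(** Everything a rule observes is a function of the packed observations, so the bounds for stopping
    times of [X] apply to every rule. *)
Lemma main_filtration_past n : main_filtration s Kn f n `<=` past X n.
Proof.
apply: smallest_sub; first exact: smallest_sigma_algebra.
move=> A [i ni [[[B _ <-]|[B _ <-]]|[j _ [B mB <-]]]]; rewrite setTI.
- apply: (@past_obs _ _ _ _ X n i [set v | B v.1.1] ni).
  exact: measurable_source.
- apply: (@past_obs _ _ _ _ X n i [set v | B v.1.2] ni).
  rewrite -[X in measurable X]setTI; exact: (@measurable_slots R 'I_k.+1 J measurableT B).
- rewrite (_ : _ @^-1` B = X i @^-1` ((fun v => (hop_re j v, hop_im j v)) @^-1` B)).
    apply: past_obs => //; rewrite -[X in measurable X]setTI.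
    exact: (measurable_fun_pair (measurable_hop_re j) (measurable_hop_im j)).
  by apply/seteqP; split=> w /=; rewrite first_hopE mxE.
Qed.

Let gens n : set_system Omega :=
  \bigcup_(i in [set i | (1 <= i <= n)%N])
        (sigma_discrete (s i) `|` sigma_discrete (Kn i) `|`
         \bigcup_(j in [set: 'I_l.+1])
            sigma_complex (fun w => first_hop s f i w ord0 j)).

Let OmegaF n := g_sigma_algebraType (gens n).

Let measurable_strength_past n i j : (1 <= i <= n)%N ->
  measurable_fun setT (fun w : OmegaF n => strength Ps (first_hop s f i w) j).
Proof.
move=> ni; under eq_fun do rewrite strength_re_im.
have gen (B : set (R * R)) : measurable B -> measurable
    ((fun w => (complex.Re (first_hop s f i w ord0 j),
       complex.Im (first_hop s f i w ord0 j))) @^-1` B : set (OmegaF n)).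
  move=> mB; apply: sub_sigma_algebra; exists i => //; right; exists j => //.
  by exists B => //; rewrite setTI.
have mpair : measurable_fun setT (fun w : OmegaF n =>
    (complex.Re (first_hop s f i w ord0 j), complex.Im (first_hop s f i w ord0 j))).
  by move=> _ B mB; rewrite setTI; exact: gen.
apply: measurable_funM => //; apply: measurable_funD; apply: measurable_funX.
  exact: (measurableT_comp measurable_fst mpair).
exact: (measurableT_comp measurable_snd mpair).
Qed.

(** [first_time_stopping] would place this event only in the larger past of [X]. Taking [OmegaF n]
    as parameter space makes lambda* and the sojourn measurable with respect to the filtration
    itself. *)
Lemma N_star_filtration gamma n : (1 <= n)%N ->
  main_filtration s Kn f n [set w | N_star T R1 R2 gamma w = Some n].
Proof.
move=> n1.
pose A i w := gamma * (T / 2) <= lambda (first_hop s f i w) *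
  sojourn (first_hop s f i w) - gamma * sojourn (first_hop s f i w).
have mA i : (1 <= i <= n)%N -> measurable [set w : OmegaF n | A i w].
  move=> ni; rewrite -[X in measurable X]setTI; apply: measurable_fun_ler => //.
  have mS := fun j => measurable_strength_past j ni.
  have mT := measurable_mean_sojourn T0 tau0 Ps0 Pr0 pr0 hsub mS.
  have mL := measurable_lambda_star T0 tau0 Ps0 Pr0 pr0 hsub mS.
  by apply: measurable_funB; exact: measurable_funM.
rewrite (_ : [set w | _] = [set w | A n w] `&`
    \bigcap_(i in [set i | (1 <= i < n)%N]) ~` [set w | A i w]).
  change (@measurable _ (OmegaF n) ([set w | A n w] `&`
    \bigcap_(i in [set i | (1 <= i < n)%N]) ~` [set w | A i w])).
  apply: measurableI; first by apply: mA; rewrite n1 leqnn.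
  rewrite bigcap_mkcond; apply: bigcapT_measurable => i; case: ifPn => //.
  rewrite inE/= => /andP[i1 ni]; apply: measurableC.
  by apply: mA; rewrite i1 ltnW.
have AE i w : ((gamma * (T / 2))%:E <= R1 i w - gamma%:E * R2 i w)%E = A i w.
  by rewrite /R1 /R2 TbarE -!EFinM -EFinB lee_fin.
apply/seteqP; split=> w /=.
  move=> /first_time_SomeP[_ An Ai]; split; first by rewrite -AE.
  by move=> i ni; apply/negP; rewrite /= -AE; exact: Ai.
move=> [An Ai]; apply/first_time_SomeP; split=> //; first by rewrite AE.
by move=> i ni; rewrite AE; apply/negP; exact: Ai.
Qed.

Let rule := stopping_rule P T tau s Kn f R2.

Let rule_stopping N : rule N -> stopping X N.
Proof.
by case=> N0 NF _ _; split=> // n n1; apply: main_filtration_past; exact: NF.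
Qed.

Lemma N_star_optimal gamma : is_gamma_star P T tau ps R1 R2 gamma ->
  rule (N_star T R1 R2 gamma) /\
  throughput P T tau Kn R1 R2 (N_star T R1 R2 gamma) =
  ereal_sup [set throughput P T tau Kn R1 R2 N | N in rule].
Proof.
move=> /is_gamma_starE gE.
(* The equation forces the sign: its left-hand side is the mean of a nonnegative variable. *)
have g0 : 0 <= gamma.
  have : (0 <= (gamma * tau / (2 * ps))%:E)%E.
    rewrite -gE; apply: integral_ge0 => w _.
    by rewrite lee_fin le_max lexx orbT.
  by rewrite lee_fin -mulrA pmulr_lge0// divr_gt0// mulr_gt0.
have [sN N0 Doo rateE] : [/\ stopping X (N_star T R1 R2 gamma),
    P [set w | N_star T R1 R2 gamma w = None] = 0%E,
    (mean_duration P T tau Kn R2 (N_star T R1 R2 gamma) < +oo)%E &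
    throughput P T tau Kn R1 R2 (N_star T R1 R2 gamma) = gamma%:E].
  rewrite R1E R2E.
  exact: (@throughput_N_star _ _ _ _ _ P X iid_main_layer T tau ps
    (fun v => v.1.2) rho1 rho2 T0 tau0 ps0 (@measurable_slots R _ _) mrho1 mrho2
    rho1_ge0 rho2_ge0 main_layer_mean_slots mean_rho2 gamma g0 gE).
have rN : rule (N_star T R1 R2 gamma).
  by split=> //; [exact: sN.1|move=> n; exact: N_star_filtration].
split=> //; apply/le_anti/andP; split.
  by apply: ereal_sup_ubound; exists (N_star T R1 R2 gamma).
rewrite rateE; apply: ge_ereal_sup => _ [N ruleN <-].
have sN' := rule_stopping ruleN; case: ruleN => _ _ N0' Doo'.
rewrite R2E in Doo'; rewrite R1E R2E.
exact: (@throughput_le _ _ _ _ _ P X iid_main_layer T tau ps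
    (fun v => v.1.2) rho1 rho2 T0 tau0 ps0 (@measurable_slots R _ _) mrho1 mrho2
    rho1_ge0 rho2_ge0 main_layer_mean_slots gamma N g0 gE sN' N0' Doo').
Qed.

End main_layer_solution.

Lemma success_prob_gt0 {R : realType} (n : nat) (p : R) : (1 <= n)%N ->
  0 < p < 1 -> 0 < success_prob n p.
Proof.
move=> n1 /andP[p0 p1].
by rewrite mulr_gt0 ?exprn_gt0 ?subr_gt0// mulr_gt0 ?ltr0n.
Qed.

Theorem theorem4 (R : realType) (K L : nat) (hK : (1 <= K)%N) (hL : (1 <= L)%N)
    (T tau Ps Pr sf2 sg2 p0 p1 : R)
    (hT : 0 < T) (htau : 0 < tau) (hPs : 0 < Ps) (hPr : 0 < Pr)
    (hsf2 : 0 < sf2) (hsg2 : 0 < sg2) (hp0 : 0 < p0 < 1) (hp1 : 0 < p1 < 1)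
    (* main layer *)
    (d : measure_display) (Omega : measurableType d) (P : probability Omega R)
    (s : nat -> Omega -> 'I_K) (Kn : nat -> Omega -> nat)
    (f : nat -> 'I_K -> 'I_L -> Omega -> R[i])
    (hmain : main_layer_model P (success_prob K p0) sf2 s Kn f)
    (* sub-layer problem, on its own probability space *)
    (d' : measure_display) (Omega' : measurableType d')
    (Q : probability Omega' R)
    (s' : nat -> Omega' -> 'I_L) (K' : nat -> Omega' -> nat)
    (g : nat -> 'I_L -> Omega' -> R[i])
    (hsub : sub_layer_model Q (success_prob L p1) sg2 s' K' g) :
  let ps := success_prob K p0 in
  let pr := success_prob L p1 in
  let lambda := lambda_star Q T tau Ps Pr pr s' g in
  let Tbar := T_bar Q T tau Ps Pr pr s' K' g in
  let R1 n w := ((lambda (first_hop s f n w))%:E * Tbar (first_hop s f n w))%E in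
  let R2 n w := Tbar (first_hop s f n w) in
  let rule := stopping_rule P T tau s Kn f R2 in
  let rate := throughput P T tau Kn R1 R2 in
  (exists gamma : R, is_gamma_star P T tau ps R1 R2 gamma) /\
  (forall gamma : R, is_gamma_star P T tau ps R1 R2 gamma ->
     rule (N_star T R1 R2 gamma) /\
     rate (N_star T R1 R2 gamma) = ereal_sup [set rate N | N in rule]).
Proof.
have ps0 := success_prob_gt0 hK hp0; have pr0 := success_prob_gt0 hL hp1.
case: K hK s f hmain ps0 => // k _ s f hmain ps0.
case: L hL f hmain s' g hsub pr0 => // l _ f hmain s' g hsub pr0.
move=> ps pr lambda Tbar R1 R2 rule rate; split.
  exact: (is_gamma_star_exists hT htau hPs hPr hsf2 ps0 pr0 hmain hsub).
move=> gamma.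
exact: (N_star_optimal hT htau hPs hPr hsf2 ps0 pr0 hmain hsub).
Qed.
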